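(* Let $X\subset T$ be a closed subscheme and let $X=X_1\cup\cdots\cup X_n$ be its decomposition into irreducible components. Then $S_{\mathrm{Trop}}(X)=S_{\mathrm{Trop}}(X_1)\sqcup\cdots\sqcup S_{\mathrm{Trop}}(X_n)$ as topological spaces, i.e., the $S_{\mathrm{Trop}}(X_i)$ are disjoint open and closed subsets of $S_{\mathrm{Trop}}(X)$ whose union is $S_{\mathrm{Trop}}(X)$.
   Context: $K$ is a field complete with respect to a (possibly trivial) non-Archimedean valuation. $M\cong\mathbb Z^r$ is a finitely generated free abelian group, $N=\mathrm{Hom}(M,\mathbb Z)$, $N_{\mathbb R}=N\otimes\mathbb R$, $T=\mathrm{Spec}(K[M])$ is the split $K$-torus with characters $\chi^u$, $u\in M$. $\mathrm{trop}\colon T^{\mathrm{an}}\to N_{\mathbb R}$ (on the Berkovich analytification) is given by $\langle u,\mathrm{trop}(\xi)\rangle=-\log|\chi^u(\xi)|$. For a closed subscheme $X\subset T$ and $\omega\in N_{\mathbb R}$, $X_\omega=\mathrm{trop}^{-1}(\omega)\cap X^{\mathrm{an}}$, a $K$-affinoid domain in $X^{\mathrm{an}}$. The Shilov boundary of an affinoid space $\mathscr M(\mathcal A)$ is the (finite) smallest subset on which every $|f|$, $f\in\mathcal A$, attains its maximum. The tropical skeleton is $S_{\mathrm{Trop}}(X)=\{\xi\in X^{\mathrm{an}}\mid\xi\text{ is a Shilov boundary point of }X_{\mathrm{trop}(\xi)}\}$, with the subspace topology from $X^{\mathrm{an}}$. *)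

(* Defs.v *)
From HB Require Import structures.
From mathcomp Require Import all_boot all_order all_algebra.
From mathcomp Require Import finmap.
From mathcomp Require Import all_classical all_reals all_analysis.

Set Implicit Arguments.
Unset Strict Implicit.
Unset Printing Implicit Defensive.

Import Order.TTheory GRing.Theory Num.Theory.
Import numFieldNormedType.Exports.

Local Open Scope classical_set_scope.
Local Open Scope ring_scope.

(* Non-Archimedean absolute values |x| = exp(- val x); the trivial one is
   allowed.  The norm of a MathComp normedZmodType is not usable here: it
   satisfies |x *+ n| = |x| *+ n. *)
Record complete_nonarch_abs (R : realType) (K : fieldType) := NonarchAbs {
  nabs :> K -> R;
  nabs_ge0 : forall x, 0 <= nabs x;
  nabs_eq0 : forall x, nabs x = 0 <-> x = 0;
  nabsM : forall x y, nabs (x * y) = nabs x * nabs y;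
  nabsD : forall x y, nabs (x + y) <= Num.max (nabs x) (nabs y);
  nabs_complete : forall s : nat -> K,
    (forall e, 0 < e -> exists n0, forall m n,
       (n0 <= m)%N -> (n0 <= n)%N -> nabs (s m - s n) < e) ->
    exists l, forall e, 0 < e -> exists n0, forall n,
       (n0 <= n)%N -> nabs (s n - l) < e }.

(* The group ring K[M]: finitely supported functions M -> K with the
   convolution product. *)
Definition group_ring (K : fieldType) (M : zmodType) : Type :=
  {fsfun M -> K with 0}.

Section GroupRing.
Variables (K : fieldType) (M : zmodType).
Implicit Types a b c : group_ring K M.

HB.instance Definition _ :=
  Choice.copy (group_ring K M) {fsfun M -> K with 0}.

Definition gr_coef a : M -> K := fun u => (a : {fsfun M -> K with 0}) u.
Definition gr_supp a : {fset M} := finsupp (a : {fsfun M -> K with 0}).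

Definition monomial (x : K) (u : M) : group_ring K M :=
  [fsfun t in [fset u]%fset => x].
Definition gr_opp a : group_ring K M :=
  [fsfun u in gr_supp a => - gr_coef a u].
Definition gr_add a b : group_ring K M :=
  [fsfun u in (gr_supp a `|` gr_supp b)%fset => gr_coef a u + gr_coef b u].
Definition gr_mul a b : group_ring K M :=
  [fsfun w in [fset (u + t)%R | u in gr_supp a, t in gr_supp b]%fset =>
     \sum_(u <- gr_supp a) gr_coef a u * gr_coef b (w - u)].

Lemma gr_eqP a b : gr_coef a =1 gr_coef b -> a = b.
Proof. by move=> ab; apply/fsfunP. Qed.

Lemma gr_coef_out a u : u \notin gr_supp a -> gr_coef a u = 0.
Proof. exact: fsfun_dflt. Qed.

Lemma monomialE x u t : gr_coef (monomial x u) t = if t == u then x else 0.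
Proof. by rewrite /gr_coef fsfunE inE. Qed.

Lemma gr_oppE a u : gr_coef (gr_opp a) u = - gr_coef a u.
Proof.
rewrite {1}/gr_coef fsfunE; case: ifPn => // /gr_coef_out ->.
by rewrite oppr0.
Qed.

Lemma gr_addE a b u : gr_coef (gr_add a b) u = gr_coef a u + gr_coef b u.
Proof.
rewrite {1}/gr_coef fsfunE in_fsetU; case: ifPn => //.
by rewrite negb_or => /andP[/gr_coef_out -> /gr_coef_out ->]; rewrite addr0.
Qed.

Lemma gr_mulE_sub a b (S : {fset M}) w : (gr_supp a `<=` S)%fset ->
  gr_coef (gr_mul a b) w = \sum_(u <- S) gr_coef a u * gr_coef b (w - u).
Proof.
move=> aS; rewrite {1}/gr_coef fsfunE.
have -> : \sum_(u <- S) gr_coef a u * gr_coef b (w - u) =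
    \sum_(u <- gr_supp a) gr_coef a u * gr_coef b (w - u).
  by apply/esym/big_fset_incl => // u _ /gr_coef_out ->; rewrite mul0r.
case: ifPn => // wab; rewrite big_seq big1// => u ua.
have [ub|/gr_coef_out ->] := boolP (w - u \in gr_supp b); last by rewrite mulr0.
by case/negP: wab; apply/imfset2P; exists u => //; exists (w - u) => //;
  rewrite addrC subrK.
Qed.

Lemma gr_mulE a b w :
  gr_coef (gr_mul a b) w =
  \sum_(u <- gr_supp a) gr_coef a u * gr_coef b (w - u).
Proof. exact: gr_mulE_sub. Qed.

Lemma gr_addA : associative gr_add.
Proof. by move=> a b c; apply: gr_eqP => u; rewrite !gr_addE addrA. Qed.

Lemma gr_addC : commutative gr_add.
Proof. by move=> a b; apply: gr_eqP => u; rewrite !gr_addE addrC. Qed.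

Lemma gr_add0 : left_id (monomial 0 0) gr_add.
Proof.
by move=> a; apply: gr_eqP => u; rewrite gr_addE monomialE if_same add0r.
Qed.

Lemma gr_addN : left_inverse (monomial 0 0) gr_opp gr_add.
Proof.
move=> a; apply: gr_eqP => u.
by rewrite gr_addE gr_oppE monomialE if_same addNr.
Qed.

HB.instance Definition _ :=
  GRing.isZmodule.Build (group_ring K M) gr_addA gr_addC gr_add0 gr_addN.

Lemma gr_mulC : commutative gr_mul.
Proof.
suff h a b w (S := [fset (w - t)%R | t in gr_supp b]%fset) :
    gr_coef (gr_mul a b) w = gr_coef (gr_mul b a) w.
  by move=> a b; apply: gr_eqP => w; exact: h.
rewrite (@gr_mulE_sub _ _ (gr_supp a `|` S)%fset) ?fsubsetUl//.
have -> : \sum_(u <- (gr_supp a `|` S)%fset) gr_coef a u * gr_coef b (w - u) =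
    \sum_(u <- S) gr_coef a u * gr_coef b (w - u).
  apply/esym/big_fset_incl; first exact: fsubsetUr.
  move=> u _ uS; have [wb|/gr_coef_out ->] := boolP (w - u \in gr_supp b).
    case/negP: uS; apply/imfsetP; exists (w - u) => //.
    by rewrite subKr.
  by rewrite mulr0.
rewrite big_imfset /=; last first.
  by move=> x y _ _ /addrI/oppr_inj.
rewrite gr_mulE; apply: eq_bigr => t _.
by rewrite subKr mulrC.
Qed.

Lemma gr_mul1 : left_id (monomial 1 0) gr_mul.
Proof.
move=> a; apply: gr_eqP => w.
rewrite (@gr_mulE_sub _ _ [fset 0]%fset); last first.
  apply/fsubsetP => u; rewrite inE; apply: contraLR => u0.
  by rewrite mem_finsupp negbK fsfunE inE (negbTE u0).
by rewrite big_seq_fset1 monomialE eqxx mul1r subr0.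
Qed.

Lemma gr_mulDl : left_distributive gr_mul gr_add.
Proof.
move=> a b c; apply: gr_eqP => w; rewrite gr_addE.
pose S := (gr_supp a `|` gr_supp b)%fset.
rewrite !(@gr_mulE_sub _ _ S) ?fsubsetUl ?fsubsetUr//; last exact: finsupp_sub.
by rewrite -big_split; apply: eq_bigr => u _; rewrite gr_addE mulrDl.
Qed.

Lemma gr_mulA : associative gr_mul.
Proof.
move=> a b c; apply: gr_eqP => w.
pose S := [fset (u + t)%R | u in gr_supp a, t in gr_supp b]%fset.
rewrite (@gr_mulE_sub (gr_mul a b) c S); last exact: finsupp_sub.
transitivity (\sum_(s <- gr_supp a) \sum_(u <- S)
   gr_coef a s * gr_coef b (u - s) * gr_coef c (w - u)); last first.
  by rewrite exchange_big /=; apply: eq_bigr => u _; rewrite gr_mulE mulr_suml.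
rewrite gr_mulE big_seq [RHS]big_seq; apply: eq_bigr => s sa.
pose S' := [fset (s + t)%R | t in gr_supp b]%fset.
have S'S : (S' `<=` S)%fset.
  by apply/fsubsetP => _ /imfsetP[t /= tb ->]; apply/imfset2P; exists s => //;
    exists t.
rewrite -(big_fset_incl _ S'S); last first.
  move=> u _ uS'; have [ub|/gr_coef_out ->] := boolP (u - s \in gr_supp b).
    by case/negP: uS'; apply/imfsetP; exists (u - s) => //; rewrite addrC subrK.
  by rewrite mulr0 mul0r.
rewrite big_imfset /=; last by move=> x y _ _ /addrI.
rewrite gr_mulE mulr_sumr; apply: eq_bigr => t _.
by rewrite mulrA -addrA -opprD [s + t - s]addrAC subrr add0r.
Qed.

Lemma gr_1neq0 : monomial 1 0 != 0.
Proof.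
apply/eqP => /(congr1 (fun a => gr_coef a 0)) /eqP.
by rewrite !monomialE eqxx oner_eq0.
Qed.

HB.instance Definition _ :=
  GRing.Zmodule_isComNzRing.Build (group_ring K M)
    gr_mulA gr_mulC gr_mul1 gr_mulDl gr_1neq0.

Definition character (u : M) : group_ring K M := monomial 1 u.

Lemma characterD u t : character (u + t) = character u * character t.
Proof.
apply: gr_eqP => w; rewrite (@gr_mulE_sub _ _ [fset u]%fset); last first.
  apply/fsubsetP => s; rewrite inE; apply: contraLR => su.
  by rewrite mem_finsupp negbK fsfunE inE (negbTE su).
by rewrite big_seq_fset1 !monomialE eqxx mul1r subr_eq [t + u]addrC.
Qed.

Lemma character0 : character 0 = 1.
Proof. by []. Qed.

End GroupRing.

Section VanishingAtInfinity.
Variable R : realType.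

Definition vanishing (I : Type) (g : I -> R) :=
  forall e, 0 < e -> finite_set [set i | e <= g i].

Lemma vanishing_bounded (I : choiceType) (g : I -> R) :
  (forall i, 0 <= g i) -> vanishing g -> exists2 C, 0 < C & forall i, g i <= C.
Proof.
move=> g0 /(_ 1 ltr01)/finite_fsetP[A hA].
have S0 : 0 <= \sum_(i <- A) g i by apply: sumr_ge0.
exists (1 + \sum_(i <- A) g i) => [|i]; first by rewrite ltr_pwDl.
have [g1|g1] := leP 1 (g i); last by rewrite (le_trans (ltW g1))// lerDl.
have iA : i \in A by have : [set` A] i by rewrite -hA.
rewrite (big_fsetD1 i)//= addrCA lerDl addr_ge0// sumr_ge0//.
Qed.

Lemma vanishingM (I J : choiceType) (g : I -> R) (h : J -> R) :
  (forall i, 0 <= g i) -> (forall j, 0 <= h j) ->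
  vanishing g -> vanishing h -> vanishing (fun p : I * J => g p.1 * h p.2).
Proof.
move=> g0 h0 vg vh e e0.
have [C C0 gC] := vanishing_bounded g0 vg.
have [D D0 hD] := vanishing_bounded h0 vh.
have eC : 0 < e / C by rewrite divr_gt0.
have eD : 0 < e / D by rewrite divr_gt0.
apply: sub_finite_set (finite_setX (vg _ eD) (vh _ eC)) => -[i j] /= egh.
split=> /=; rewrite ler_pdivrMr//; apply: le_trans egh _.
  by rewrite ler_wpM2l.
by rewrite mulrC ler_wpM2l.
Qed.

End VanishingAtInfinity.

Section UnconditionalSum.
Variables (R : realType) (K : fieldType) (v : complete_nonarch_abs R K).

Definition null_family (I : choiceType) (f : I -> K) :=
  vanishing (fun i => v (f i)).

Definition sums_to (I : choiceType) (f : I -> K) (s : K) :=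
  forall e, 0 < e -> exists A : {fset I}, forall B : {fset I},
    (A `<=` B)%fset -> v (s - \sum_(i <- B) f i) < e.

(* the sum of a summable family, and 0 otherwise *)
Definition usum (I : choiceType) (f : I -> K) : K := xget 0 [set s | sums_to f s].

Lemma nabs0 : v 0 = 0.
Proof. exact/nabs_eq0. Qed.

Lemma nabs_gt0 x : x != 0 -> 0 < v x.
Proof.
by move=> x0; rewrite lt_neqAle nabs_ge0 andbT eq_sym; apply: contra_neq x0;
  exact: (nabs_eq0 v x).1.
Qed.

Lemma nabs1 : v 1 = 1.
Proof.
have v1 : v 1 != 0 by rewrite gt_eqF// nabs_gt0// oner_eq0.
by apply: (mulfI v1); rewrite -nabsM !mulr1.
Qed.

Lemma nabsN x : v (- x) = v x.
Proof.
have vN1 : v (-1) = 1.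
  have : v (-1) ^+ 2 = 1 by rewrite expr2 -nabsM mulrNN mulr1 nabs1.
  by move/eqP; rewrite sqrp_eq1 ?nabs_ge0// => /eqP.
by rewrite -mulN1r nabsM vN1 mul1r.
Qed.

Lemma nabsD_lt x y e : v x < e -> v y < e -> v (x + y) < e.
Proof. by move=> xe ye; rewrite (le_lt_trans (nabsD _ _ _))// gt_max xe ye. Qed.

Lemma nabsB_lt x y e : v x < e -> v y < e -> v (x - y) < e.
Proof. by move=> xe ye; rewrite nabsD_lt// nabsN. Qed.

Lemma nabs_distC x y : v (x - y) = v (y - x).
Proof. by rewrite -opprB nabsN. Qed.

Lemma nabs_sum_lt (I : choiceType) (r : seq I) (P : pred I) (f : I -> K) e :
  0 < e -> (forall i, i \in r -> P i -> v (f i) < e) ->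
  v (\sum_(i <- r | P i) f i) < e.
Proof.
move=> e0 fe; rewrite big_seq_cond.
apply: (big_ind (fun x => v x < e)); first by rewrite nabs0.
  by move=> x y; exact: nabsD_lt.
by move=> i /andP[ir Pi]; exact: fe.
Qed.

Lemma nabs_small_eq0 x : (forall e, 0 < e -> v x < e) -> x = 0.
Proof.
move=> xe; apply/eqP/negP => /negP /nabs_gt0 x0.
by have := xe _ x0; rewrite ltxx.
Qed.

Section OneIndex.
Variable I : choiceType.
Implicit Types (f g : I -> K) (s : K).

Lemma sums_to_uniq f s t : sums_to f s -> sums_to f t -> s = t.
Proof.
move=> fs ft; apply/eqP; rewrite -subr_eq0; apply/eqP/nabs_small_eq0 => e e0.
have [A hA] := fs _ e0; have [B hB] := ft _ e0.
pose x := \sum_(i <- (A `|` B)%fset) f i.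
have -> : s - t = (s - x) - (t - x) by rewrite opprB addrA subrK.
by apply: nabsB_lt; [apply: hA; exact: fsubsetUl|apply: hB; exact: fsubsetUr].
Qed.

Lemma usumE f s : sums_to f s -> usum f = s.
Proof.
move=> fs; apply: (@sums_to_uniq f) => //.
by apply: (@xgetPex _ 0 [set t | sums_to f t]); exists s.
Qed.

Lemma sum_tail f e (A B C : {fset I}) : 0 < e ->
  (forall i, i \notin A -> v (f i) < e) ->
  (A `<=` B)%fset -> (A `<=` C)%fset ->
  v (\sum_(i <- B) f i - \sum_(i <- C) f i) < e.
Proof.
move=> e0 fA.
suff h D : (A `<=` D)%fset -> v (\sum_(i <- D) f i - \sum_(i <- A) f i) < e.
  move=> AB AC; rewrite -(subrKA (\sum_(i <- A) f i)).
  by apply: nabsD_lt; [exact: h|rewrite nabs_distC; exact: h].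
move=> AD; rewrite (big_fsetID _ (mem A))/=.
have -> : [fset x | x in D & x \in A]%fset = A.
  by apply/fsetP => x; rewrite !inE/= andbC; case: (boolP (x \in A)) => //= /(fsubsetP AD).
rewrite addrAC subrr add0r; apply: nabs_sum_lt => // i.
by rewrite !inE/= => /andP[_ iA] _; exact: fA.
Qed.

Lemma null_familyP f e : null_family f -> 0 < e ->
  exists A : {fset I}, forall i, i \notin A -> v (f i) < e.
Proof.
move=> nf e0; have /finite_fsetP[A Ae] := nf _ e0; exists A => i iA.
rewrite ltNge; apply: contra iA => fi.
by have : [set` A] i by rewrite -Ae.
Qed.

Lemma null_usum f : null_family f -> sums_to f (usum f).
Proof.
move=> nf; suff [s fs] : exists s, sums_to f s by rewrite (usumE fs).
have inv_gt0 n : 0 < n.+1%:R^-1 :> R by rewrite invr_gt0.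
have [A hA] := @choice _ _ _ (fun n => null_familyP nf (inv_gt0 n)).
pose U (n : nat) : {fset I} := (\bigcup_(i <- iota 0 n.+1) A i)%fset.
have AU m n : (m <= n)%N -> (A m `<=` U n)%fset.
  by move=> mn; apply: bigfcup_sup => //; rewrite mem_iota add0n ltnS.
have ex_small (e : R) : 0 < e -> exists n, n.+1%:R^-1 < e.
  move=> e0; have [n _ hn] := near_infty_natSinv_lt (PosNum e0).
  by exists n; apply: hn => /=.
have [|l hl] := @nabs_complete _ _ v (fun n => \sum_(i <- U n) f i).
  move=> e /ex_small[n ne]; exists n => p q np nq; apply: lt_trans ne.
  by apply: (@sum_tail f _ (A n)) => //; [exact: hA|exact: AU|exact: AU].
exists l => e e0; have [n ne] := ex_small _ e0; have [m hm] := hl _ e0.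
exists (A n) => B AB; pose p := maxn m n.
rewrite -(subrKA (\sum_(i <- U p) f i)); apply: nabsD_lt.
  by rewrite nabs_distC; apply: hm; exact: leq_maxl.
apply: lt_trans ne; apply: (@sum_tail f _ (A n)) => //; first exact: hA.
by apply: AU; exact: leq_maxr.
Qed.

Lemma usum_approx f e (A : {fset I}) : null_family f -> 0 < e ->
  (forall i, i \notin A -> v (f i) < e) -> v (usum f - \sum_(i <- A) f i) < e.
Proof.
move=> /null_usum fs e0 fA; have [B hB] := fs _ e0.
rewrite -(subrKA (\sum_(i <- (A `|` B)%fset) f i)); apply: nabsD_lt.
  exact/hB/fsubsetUr.
by apply: (@sum_tail f _ A) => //; exact: fsubsetUl.
Qed.

Lemma usum_lt f e : null_family f -> 0 < e -> (forall i, v (f i) < e) ->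
  v (usum f) < e.
Proof.
move=> nf e0 fe; have := @usum_approx f e fset0 nf e0 (fun i _ => fe i).
by rewrite big_nil subr0.
Qed.

Lemma usumD f g : null_family f -> null_family g ->
  usum (fun i => f i + g i) = usum f + usum g.
Proof.
move=> /null_usum fs /null_usum gs; apply: usumE => e e0.
have [A hA] := fs _ e0; have [B hB] := gs _ e0.
exists (A `|` B)%fset => C; rewrite fsubUset => /andP[AC BC].
rewrite big_split /= opprD addrACA.
by apply: nabsD_lt; [exact: hA|exact: hB].
Qed.

Lemma usumZ x f : null_family f -> usum (fun i => x * f i) = x * usum f.
Proof.
move=> /null_usum fs; have [->|x0] := eqVneq x 0.
  rewrite mul0r; apply: usumE => e e0; exists fset0 => B _.
  by rewrite -mulr_sumr mul0r subr0 nabs0.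
apply: usumE => e e0; have vx := nabs_gt0 x0.
have [|A hA] := fs (e / v x); first by rewrite divr_gt0.
exists A => B /hA; rewrite -mulr_sumr -mulrBr nabsM.
by rewrite ltr_pdivlMr// mulrC.
Qed.

Lemma usum1 f j : (forall i, i != j -> f i = 0) -> usum f = f j.
Proof.
move=> fj; apply: usumE => e e0; exists [fset j]%fset => B jB.
rewrite -(big_fset_incl _ jB); last by move=> i _; rewrite inE => /fj.
by rewrite big_seq_fset1 subrr nabs0.
Qed.

End OneIndex.

Lemma usum_reindex (I J : choiceType) (h : J -> I) (k : I -> J) (f : I -> K) :
  cancel h k -> cancel k h -> null_family f -> usum (f \o h) = usum f.
Proof.
move=> hk kh /null_usum fs; apply: usumE => e e0; have [A hA] := fs _ e0.
exists (k @` A)%fset => B AB.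
have := hA (h @` B)%fset; rewrite big_imfset/=; last first.
  by move=> x y _ _; exact: can_inj hk _ _.
apply; apply/fsubsetP => i iA; apply/imfsetP; exists (k i) => //.
by apply: (fsubsetP AB); apply/imfsetP; exists i.
Qed.

Lemma null_familyM (I J : choiceType) (F : I -> J -> K) :
  null_family (fun p : I * J => F p.1 p.2) -> forall i, null_family (F i).
Proof.
move=> nF i e e0; apply: sub_finite_set (finite_image snd (nF e e0)).
by move=> j /= Fij; exists (i, j).
Qed.

Lemma usum_box (I J : choiceType) (F : I -> J -> K) e :
  null_family (fun p : I * J => F p.1 p.2) -> 0 < e ->
  exists (A : {fset I}) (B : {fset J}), forall i j,
    (i \notin A) || (j \notin B) -> v (F i j) < e.
Proof.
move=> nF e0; have [P hP] := null_familyP nF e0.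
exists (fst @` P)%fset, (snd @` P)%fset => i j ij.
apply: (hP (i, j)); apply/negP => ijP; move: ij; rewrite -negb_and => /negP.
by apply; apply/andP; split; apply/imfsetP; exists (i, j).
Qed.

Lemma null_usum2 (I J : choiceType) (F : I -> J -> K) :
  null_family (fun p : I * J => F p.1 p.2) ->
  null_family (fun i => usum (F i)).
Proof.
move=> nF e e0; have [A [B hAB]] := usum_box nF e0.
apply: sub_finite_set (finite_fset A) => i /= ei; apply/negPn/negP => iA.
have : v (usum (F i)) < e.
  apply: usum_lt => // [|j]; first exact: null_familyM.
  by apply: hAB; rewrite iA.
by rewrite ltNge ei.
Qed.

Lemma usum_approx2 (I J : choiceType) (F : I -> J -> K) e
    (A : {fset I}) (B : {fset J}) :
  null_family (fun p : I * J => F p.1 p.2) -> 0 < e ->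
  (forall i j, (i \notin A) || (j \notin B) -> v (F i j) < e) ->
  v (usum (fun i => usum (F i)) - \sum_(i <- A) \sum_(j <- B) F i j) < e.
Proof.
move=> nF e0 hAB; have nFi := null_familyM nF.
rewrite -(subrKA (\sum_(i <- A) usum (F i))); apply: nabsD_lt.
  apply: usum_approx => //; first exact: null_usum2.
  by move=> i iA; apply: usum_lt => // j; apply: hAB; rewrite iA.
rewrite -sumrB; apply: nabs_sum_lt => // i _ _; apply: usum_approx => // j jB.
by apply: hAB; rewrite jB orbT.
Qed.

Lemma usum_exchange (I J : choiceType) (F : I -> J -> K) :
  null_family (fun p : I * J => F p.1 p.2) ->
  usum (fun i => usum (F i)) = usum (fun j => usum (fun i => F i j)).
Proof.
move=> nF; apply/eqP; rewrite -subr_eq0; apply/eqP/nabs_small_eq0 => e e0.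
have nG : null_family (fun p : J * I => F p.2 p.1).
  move=> d d0; apply: sub_finite_set (finite_image (fun p => (p.2, p.1)) (nF d d0)).
  by move=> [j i] /= Fij; exists (i, j).
have [A [B hAB]] := usum_box nF e0.
rewrite -(subrKA (\sum_(i <- A) \sum_(j <- B) F i j)); apply: nabsD_lt.
  exact: usum_approx2.
rewrite nabs_distC exchange_big/=.
by apply: (@usum_approx2 _ _ (fun j i => F i j)) => // j i; rewrite orbC; exact: hAB.
Qed.

End UnconditionalSum.

(* K{U_omega}: the series sum_u a_u chi^u with |a_u| exp(- omega u) -> 0 for
   the filter of complements of finite sets, i.e. the K-affinoid algebra of
   U_omega = trop^-1(omega) in T^an.  N_R is realized as the group of additive
   maps M -> R. *)
Record tate (R : realType) (K : fieldType) (v : complete_nonarch_abs R K)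
    (M : zmodType) (omega : {additive M -> R}) := Tate {
  tcoef :> M -> K;
  tcoefP : vanishing (fun u => v (tcoef u) * expR (- omega u)) }.

Section TateAlgebra.
Variables (R : realType) (K : fieldType) (v : complete_nonarch_abs R K).
Variables (M : zmodType) (omega : {additive M -> R}).
Local Notation T := (tate v omega).
Implicit Types a b c : T.

HB.instance Definition _ := gen_eqMixin T.
HB.instance Definition _ := gen_choiceMixin T.

Let W u := expR (- omega u).
Let nm (f : M -> K) u := v (f u) * W u.

Let W_gt0 u : 0 < W u. Proof. exact: expR_gt0. Qed.

Let WD u t : W (u + t) = W u * W t.
Proof. by rewrite /W raddfD opprD expRD. Qed.

Let nm_ge0 f u : 0 <= nm f u.
Proof. by rewrite mulr_ge0 ?nabs_ge0// ltW. Qed.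

Lemma tate_eqP a b : a =1 b -> a = b.
Proof.
case: a b => [a aP] [b bP] /= /funext ab; case: _ / ab in bP *.
by congr Tate; exact: Prop_irrelevance.
Qed.

Lemma tate_finP (f : M -> K) (A : {fset M}) :
  (forall u, u \notin A -> f u = 0) -> vanishing (nm f).
Proof.
move=> fA e e0; apply: sub_finite_set (finite_fset A) => u /= eu.
apply/negPn/negP => /fA fu; move: eu.
by rewrite /nm fu nabs0 mul0r leNgt e0.
Qed.

Lemma tate_oppP a : vanishing (nm (fun u => - a u)).
Proof.
move=> e e0; apply: sub_finite_set (tcoefP a e0) => u /=.
by rewrite /nm nabsN.
Qed.

Lemma tate_addP a b : vanishing (nm (fun u => a u + b u)).
Proof.
move=> e e0; have aP := tcoefP a e0; have bP := tcoefP b e0.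
apply: (@sub_finite_set _ _ (_ `|` _)) ; last first.
  by rewrite finite_setU; split; [exact: aP|exact: bP].
move=> u /= eu; apply/orP; apply/contraT.
rewrite negb_or -!ltNge => /andP[au bu]; move: eu.
rewrite -ler_pdivrMr; last exact: W_gt0.
by rewrite leNgt nabsD_lt// ltr_pdivlMr ?W_gt0.
Qed.

Let nmM a b : vanishing (fun p : M * M => nm a p.1 * nm b p.2).
Proof.
by apply: vanishingM; [exact: nm_ge0|exact: nm_ge0|exact: tcoefP|exact: tcoefP].
Qed.

Lemma tate_mul_null a b w : null_family v (fun u => a u * b (w - u)).
Proof.
move=> e e0; have eW : 0 < e * W w by rewrite mulr_gt0.
apply: sub_finite_set (finite_image fst (nmM a b eW)) => u /= eu.
exists (u, w - u) => //=; rewrite mulrACA -nabsM -WD [u + _]addrC subrK.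
by rewrite ler_pM2r.
Qed.

Lemma tate_mulP a b :
  vanishing (nm (fun w => usum v (fun u => a u * b (w - u)))).
Proof.
move=> e e0.
apply: sub_finite_set (finite_image (fun p => p.1 + p.2) (nmM a b e0)) => w /=.
move=> ew; apply: contrapT => nw; move: ew; apply/negP; rewrite -ltNge.
rewrite -ltr_pdivlMr//; apply: usum_lt; first exact: tate_mul_null.
  by rewrite divr_gt0.
move=> u; rewrite ltr_pdivlMr// ltNge; apply/negP => eu; apply: nw.
exists (u, w - u) => /=; last by rewrite addrC subrK.
by rewrite mulrACA -nabsM -WD [u + _]addrC subrK.
Qed.

Lemma tate_of_group_ringP (f : group_ring K M) : vanishing (nm (gr_coef f)).
Proof. by apply: tate_finP => u; exact: gr_coef_out. Qed.

Definition tate_of_group_ring (f : group_ring K M) : T :=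
  Tate (@tate_of_group_ringP f).

Definition tate_opp a : T := Tate (@tate_oppP a).
Definition tate_add a b : T := Tate (@tate_addP a b).
Definition tate_mul a b : T := Tate (@tate_mulP a b).

Lemma tate_addA : associative tate_add.
Proof. by move=> a b c; apply: tate_eqP => u /=; rewrite addrA. Qed.

Lemma tate_addC : commutative tate_add.
Proof. by move=> a b; apply: tate_eqP => u /=; rewrite addrC. Qed.

Lemma tate_add0 : left_id (tate_of_group_ring 0) tate_add.
Proof. by move=> a; apply: tate_eqP => u /=; rewrite monomialE if_same add0r. Qed.

Lemma tate_addN : left_inverse (tate_of_group_ring 0) tate_opp tate_add.
Proof. by move=> a; apply: tate_eqP => u /=; rewrite monomialE if_same addNr. Qed.

HB.instance Definition _ :=
  GRing.isZmodule.Build T tate_addA tate_addC tate_add0 tate_addN.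

Lemma tate_mulC : commutative tate_mul.
Proof.
move=> a b; apply: tate_eqP => w /=.
rewrite -(@usum_reindex _ _ v _ _ (fun u => w - u) (fun u => w - u)).
- by congr usum; apply/funext => u /=; rewrite subKr mulrC.
- exact: subKr.
- exact: subKr.
- exact: tate_mul_null.
Qed.

Lemma tate_mul1 : left_id (tate_of_group_ring 1) tate_mul.
Proof.
move=> a; apply: tate_eqP => w /=; rewrite (@usum1 _ _ v _ _ 0) => [|u u0].
  by rewrite monomialE eqxx mul1r subr0.
by rewrite monomialE (negbTE u0) mul0r.
Qed.

Lemma tate_mulDl : left_distributive tate_mul tate_add.
Proof.
move=> a b c; apply: tate_eqP => w /=.
rewrite -usumD; [|exact: tate_mul_null|exact: tate_mul_null].
by congr usum; apply/funext => u; rewrite mulrDl.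
Qed.

Lemma tate_mulA : associative tate_mul.
Proof.
move=> a b c; apply: tate_eqP => w /=.
pose F u s := a s * b (u - s) * c (w - u).
have nF : null_family v (fun p : M * M => F p.1 p.2).
  move=> e e0; have eW : 0 < e * W w by rewrite mulr_gt0.
  have abc : vanishing (fun p : M * M * M => nm a p.1.1 * nm b p.1.2 * nm c p.2).
    apply: (@vanishingM _ _ _ (fun p : M * M => nm a p.1 * nm b p.2)).
    - by move=> p; rewrite mulr_ge0.
    - exact: nm_ge0.
    - exact: nmM.
    - exact: tcoefP.
  apply: sub_finite_set
    (finite_image (fun p => (p.1.1 + p.1.2, p.1.1)) (abc _ eW)) => -[u s] /= eu.
  exists (s, u - s, w - u) => /=; last by rewrite [s + _]addrC subrK.
  rewrite [nm a s * _]mulrACA -nabsM mulrACA -nabsM -!WD.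
  have -> : s + (u - s) + (w - u) = w by rewrite [s + _]addrC subrK addrC subrK.
  by rewrite ler_pM2r.
transitivity (usum v (fun u => usum v (F u))); last first.
  congr usum; apply/funext => u /=; rewrite mulrC -usumZ; last first.
    exact: tate_mul_null.
  by congr usum; apply/funext => s; rewrite mulrC.
rewrite (usum_exchange nF); congr usum; apply/funext => s /=.
rewrite -usumZ; last exact: tate_mul_null.
rewrite -(@usum_reindex _ _ v _ _ (fun u => u - s) (fun u => u + s)).
- congr usum; apply/funext => u /=.
  by rewrite /F mulrA opprB addrA subrK.
- exact: subrK.
- exact: addrK.
- move=> e e0.
  have [->|as0] := eqVneq (a s) 0.
    by apply: sub_finite_set (finite_set0 _) => u /=; rewrite mul0r nabs0 leNgt e0.
  have eas : 0 < e / v (a s) by rewrite divr_gt0// nabs_gt0.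
  apply: sub_finite_set (tate_mul_null b c (w - s) eas) => u /=.
  by rewrite nabsM mulrC ler_pdivrMr// nabs_gt0.
Qed.

Lemma tate_1neq0 : tate_of_group_ring 1 != 0.
Proof.
apply/eqP => /(congr1 (fun a : T => a 0)) /eqP /=.
by rewrite !monomialE eqxx oner_eq0.
Qed.

HB.instance Definition _ :=
  GRing.Zmodule_isComNzRing.Build T
    tate_mulA tate_mulC tate_mul1 tate_mulDl tate_1neq0.

(* max_u |a_u| exp(- omega u), the supremum being attained *)
Definition tate_norm a : R := sup (range (fun u => v (a u) * expR (- omega u))).

Lemma tate_of_group_ring_is_zmod_morphism : zmod_morphism tate_of_group_ring.
Proof.
move=> f g; apply: tate_eqP => u.
exact: (etrans (gr_addE _ _ _) (congr1 _ (gr_oppE _ _))).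
Qed.

Lemma tate_of_group_ring_is_monoid_morphism :
  monoid_morphism tate_of_group_ring.
Proof.
split=> // f g; apply: tate_eqP => w /=; rewrite gr_mulE.
apply/esym/usumE => e e0; exists (gr_supp f) => B fB.
rewrite -(big_fset_incl _ fB) ?subrr ?nabs0// => u _ /gr_coef_out ->.
by rewrite mul0r.
Qed.

HB.instance Definition _ := GRing.isZmodMorphism.Build (group_ring K M) T
  tate_of_group_ring tate_of_group_ring_is_zmod_morphism.
HB.instance Definition _ := GRing.isMonoidMorphism.Build (group_ring K M) T
  tate_of_group_ring tate_of_group_ring_is_monoid_morphism.

End TateAlgebra.

Record mseminorm (A : comNzRingType) (R : realType) := MSeminorm {
  msn :> A -> R;
  msn_ge0 : forall f, 0 <= msn f;
  msn0 : msn 0 = 0;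
  msn1 : msn 1 = 1;
  msnM : forall f g, msn (f * g) = msn f * msn g;
  msnD : forall f g, msn (f + g) <= msn f + msn g }.

HB.instance Definition _ (A : comNzRingType) (R : realType) :=
  gen_eqMixin (mseminorm A R).
HB.instance Definition _ (A : comNzRingType) (R : realType) :=
  gen_choiceMixin (mseminorm A R).

(* The coarsest topology making all the evaluations xi |-> |f(xi)| continuous. *)
HB.instance Definition _ (A : comNzRingType) (R : realType) :=
  Topological.copy (mseminorm A R)
    (initial_topology (@msn A R : mseminorm A R -> {ptws A -> R})).

Section Ideals.
Variable A : comNzRingType.
Implicit Types (I P Z : set A) (X Y : set (set A)).

(* MathComp's idealr_closed only covers proper ideals. *)
Definition is_ideal I :=
  [/\ I 0, forall f g, I f -> I g -> I (f + g) & forall f g, I g -> I (f * g)].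

Definition ideal_generated (E : set A) : set A := smallest is_ideal E.

Definition is_prime_ideal P :=
  idealr_closed [in P] /\ prime_idealr_closed [in P].

(* Spec A is the set of the prime ideals of A, V(E) = zeros E its closed
   subsets. *)
Definition zeros (E : set A) : set (set A) :=
  [set P | is_prime_ideal P /\ E `<=` P].

Definition zariski_closed X := exists E, X = zeros E.

Definition irreducible_set X :=
  X !=set0 /\ forall F G, zariski_closed F -> zariski_closed G ->
    X `<=` F `|` G -> X `<=` F \/ X `<=` G.

(* the irreducible components of a subset X of Spec A *)
Definition irreducible_component X : set (set (set A)) :=
  [set Y | [/\ Y `<=` X, irreducible_set Y &
     forall Y', Y' `<=` X -> irreducible_set Y' -> Y `<=` Y' -> Y' = Y]].

(* the ideal of the reduced closed subscheme with underlying set the closed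
   subset X of Spec A *)
Definition vanishing_ideal X : set A := \bigcap_(P in X) P.

End Ideals.

Section BerkovichSpectrum.
Variables (A : comNzRingType) (R : realType).
Implicit Types S G : set (mseminorm A R).

(* The Berkovich spectrum of A / J, for the residue seminorm of N: a seminorm
   on A / J is a seminorm on A vanishing on J, and it is bounded by the residue
   seminorm up to a constant iff it is bounded by N up to the same constant. *)
Definition spectrum (N : A -> R) (J : set A) : set (mseminorm A R) :=
  [set xi | (exists C, forall f, xi f <= C * N f) /\ forall f, J f -> xi f = 0].

(* S stands for the spectrum of some quotient of A.  Closedness is required:
   the |f| also attain their maxima on many sets which are not closed, and
   there is in general no smallest one without this condition. *)
Definition is_boundary S G :=
  [/\ G `<=` S, closed (G : set (subspace S)) &
   forall f : A, S !=set0 -> exists2 xi, G xi & forall eta, S eta -> eta f <= xi f].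

Definition shilov_boundary S : set (mseminorm A R) :=
  smallest (is_boundary S) set0.

End BerkovichSpectrum.

Section Tropical.
Variables (R : realType) (K : fieldType) (v : complete_nonarch_abs R K).
Variable M : zmodType.
Local Notation KM := (group_ring K M).
Implicit Types (I : set KM) (xi : mseminorm KM R).

(* A closed subscheme X of T is given by its ideal I; X^an is identified with a
   closed subspace of T^an. *)
Definition analytification I : set (mseminorm KM R) :=
  [set xi | (forall x : K, xi (monomial x 0) = v x) /\ forall f, I f -> xi f = 0].

Definition trop_fun xi : M -> R := fun u => - ln (xi (character K u)).

Lemma msn_character_gt0 xi u : 0 < xi (character K u).
Proof.
rewrite lt_neqAle msn_ge0 andbT eq_sym; apply/eqP => xi0.
have := msn1 xi; rewrite -character0 -(subrr u) characterD msnM xi0 mul0r.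
by move/eqP; rewrite eq_sym oner_eq0.
Qed.

Lemma trop_fun_is_zmod_morphism xi : zmod_morphism (trop_fun xi).
Proof.
suff tD u t : trop_fun xi (u + t) = trop_fun xi u + trop_fun xi t.
  by move=> u t; rewrite -[u in RHS](subrK t) [trop_fun xi (u - t + t)]tD addrK.
by rewrite /trop_fun characterD msnM lnM ?posrE ?msn_character_gt0// opprD.
Qed.

HB.instance Definition _ xi :=
  GRing.isZmodMorphism.Build M R (trop_fun xi) (trop_fun_is_zmod_morphism xi).

Definition trop xi : {additive M -> R} := trop_fun xi.

(* M(A_omega) for the affinoid algebra A_omega = K{U_omega} / I K{U_omega} of
   X_omega *)
Definition tropical_fiber I (omega : {additive M -> R}) :
    set (mseminorm (tate v omega) R) :=
  spectrum (@tate_norm _ _ v _ omega)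
    (ideal_generated (@tate_of_group_ring _ _ v _ omega @` I)).

(* A point of X_omega, as a subset of X^an, is the restriction to K[M] of a
   unique point of M(A_omega). *)
Definition tropical_skeleton I : set (mseminorm KM R) :=
  [set xi | analytification I xi /\
     exists2 eta, shilov_boundary (@tropical_fiber I (trop xi)) eta &
       forall f, xi f = eta (tate_of_group_ring v (trop xi) f)].

End Tropical.

(* Main.v *)
(* For a prime ideal P and h outside P, a Groebner basis of (h) + P with respect
   to the weighted Gauss norm (leading exponents exist by finiteness of supports,
   and finitely many of them suffice by Dickson's lemma) shows that h has bounded
   division: the residue norm on the affinoid algebra of the fiber X_omega,
   X = V(P), satisfies t |f| <= |h f| for some t > 0. This bound passes to the
   spectral seminorm, and minimal seminorms being multiplicative, every |f|
   attains its maximum over X_omega at a point where |h| >= t. The points with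
   |h| >= t thus form a closed boundary, so that a Shilov point of X_omega has
   kernel exactly P on K[M]: it lies on no smaller closed subscheme.

   For X with components X_i, a union of boundaries of the (X_i)_omega is a
   boundary of X_omega; conversely a boundary G of X_omega cuts out a boundary of
   (X_i)_omega, as one sees by maximizing |f^k h| for k -> oo with h vanishing on
   all the components but X_i. Hence S_Trop(X) is the union of the S_Trop(X_i), and
   by the statement on kernels S_Trop(X_i) consists of the points of S_Trop(X) on
   X_i, a closed condition, and the S_Trop(X_i) are disjoint. *)

Require Import Defs.
From mathcomp Require Import all_boot all_order all_algebra.
From mathcomp Require Import finmap.
From mathcomp Require Import all_classical all_reals all_analysis.
From mathcomp Require Import ring lra zify.

Set Implicit Arguments.
Unset Strict Implicit.
Unset Printing Implicit Defensive.

Import Order.TTheory GRing.Theory Num.Theory.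
Import numFieldNormedType.Exports.

Local Open Scope classical_set_scope.
Local Open Scope ring_scope.

(** * Multiplicative seminorms below a ring seminorm *)

(** If b < a, then (b/a)^n tends to 0 and drops below 1/C. This is how multiplicative constants are
    removed below: pass to n-th powers. *)
Lemma le_of_expr_le (R : realType) (a b C : R) : 0 <= a -> 0 <= b ->
  (forall n, a ^+ n <= C * b ^+ n) -> a <= b.
Proof.
move=> a0 b0 ab; rewrite leNgt; apply/negP => ba.
have C0 : 0 < C by have := ab 0%N; rewrite !expr0 mulr1; lra.
have [b00|bn0] := eqVneq b 0.
  by have := ab 1%N; rewrite !expr1 b00 mulr0; lra.
have bp : 0 < b by lra.
pose q := b / a; have q0 : 0 <= q by rewrite divr_ge0.
have q1 : `|q| < 1 by rewrite ger0_norm// ltr_pdivrMr; lra.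
have Ci : 0 < C^-1 by rewrite invr_gt0.
have := cvg_expr q1 => /cvgrPdist_lt /(_ _ Ci) [m _ /(_ m (leqnn m))] /=.
rewrite sub0r normrN ger0_norm ?exprn_ge0// exprMn exprVn.
rewrite ltr_pdivrMr ?exprn_gt0 ?(lt_trans bp)//.
rewrite -[X in X < _](mulKf (lt0r_neq0 C0)) ltr_pM2l// => h.
by have := ab m; rewrite leNgt h.
Qed.

Lemma le_mul_approx (R : realType) (x y z : R) : 0 <= x -> 0 <= y ->
  (forall a b, x < a -> y < b -> z <= a * b) -> z <= x * y.
Proof.
move=> x0 y0 h; rewrite leNgt; apply/negP => zxy.
(* As 0 < d <= 1, (x + d)(y + d) <= xy + d(x + y + 1) < xy + d(x + y + 2) <= z. *)
pose d := Num.min 1 ((z - x * y) / (x + y + 2)).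
have d0 : 0 < d by rewrite lt_min ltr01 divr_gt0//; lra.
have := h (x + d) (y + d); rewrite !ltrDl => /(_ d0 d0); apply/negP.
rewrite -ltNge.
have d1 : d <= 1 by rewrite ge_min lexx.
have dz : d * (x + y + 2) <= z - x * y.
  by rewrite -ler_pdivlMr ?ge_min ?lexx ?orbT//; lra.
have xd : 0 <= x * d by rewrite mulr_ge0// ltW.
nra.
Qed.

Lemma le_of_ltr (R : realType) (x z : R) : (forall a, x < a -> z <= a) -> z <= x.
Proof.
move=> h; apply/ler_addgt0Pr => e e0; apply: h; rewrite ltrDl//.
Qed.

Lemma msnX (A : comNzRingType) (R : realType) (xi : mseminorm A R) f n :
  xi (f ^+ n) = xi f ^+ n.
Proof. by elim: n => [|n IHn]; rewrite ?expr0 ?msn1// !exprS msnM IHn. Qed.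

Record ring_seminorm (A : comNzRingType) (R : realType) (p : A -> R) := RingSeminorm {
  rsn_ge0 : forall f, 0 <= p f;
  rsn0 : p 0 = 0;
  rsn1 : p 1 = 1;
  rsnM : forall f g, p (f * g) <= p f * p g;
  rsnD : forall f g, p (f + g) <= Num.max (p f) (p g) }.

Section RingSeminorm.
Variables (A : comNzRingType) (R : realType).
Implicit Types (p q : A -> R) (a b f g h : A).

Lemma rsnX p f n : ring_seminorm p -> p (f ^+ n) <= p f ^+ n.
Proof.
move=> ps; elim: n => [|n IHn]; first by rewrite !expr0 (rsn1 ps).
by rewrite !exprS (le_trans (rsnM ps _ _))// ler_wpM2l// (rsn_ge0 ps).
Qed.

Lemma rsnMn p f n : ring_seminorm p -> p (f *+ n) <= p f.
Proof.
move=> ps; elim: n => [|n IHn]; first by rewrite mulr0n (rsn0 ps) (rsn_ge0 ps).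
by rewrite mulrS (le_trans (rsnD ps _ _))// ge_max lexx.
Qed.

Lemma rsn_sum p (I : eqType) (r : seq I) (F : I -> A) e : ring_seminorm p ->
  0 <= e -> (forall i, i \in r -> p (F i) <= e) -> p (\sum_(i <- r) F i) <= e.
Proof.
move=> ps e0 Fe; rewrite big_seq; elim/big_ind : _ => //; first by rewrite (rsn0 ps).
by move=> x y xe ye; rewrite (le_trans (rsnD ps _ _))// ge_max xe.
Qed.

Section DirectedInf.
Variables (I : Type) (i0 : I) (P : I -> A -> R).
Hypothesis P_ge0 : forall i f, 0 <= P i f.

(** Three constructions share this infimum: localizations, lower bounds of chains in Zorn's lemma,
    and residue norms. *)
Definition dinf f := inf (range (fun i => P i f)).

Let has_infP f : has_inf (range (fun i => P i f)).
Proof.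
split; first by exists (P i0 f); exists i0.
by exists 0 => _ [i _ <-].
Qed.

Lemma dinf_ge0 f : 0 <= dinf f.
Proof. by apply: lb_le_inf; [case: (has_infP f)|move=> _ [i _ <-]]. Qed.

Lemma dinf_le i f : dinf f <= P i f.
Proof. by apply: ge_inf; [case: (has_infP f)|exists i]. Qed.

Lemma dinf_ge f x : (forall i, x <= P i f) -> x <= dinf f.
Proof. by move=> h; apply: lb_le_inf; [case: (has_infP f)|move=> _ [i _ <-]]. Qed.

Lemma dinf_lt f x : dinf f < x -> exists i, P i f < x.
Proof.
move=> fx; have d0 : 0 < x - dinf f by rewrite subr_gt0.
have [_ [i _ <-] h] := inf_adherent d0 (has_infP f).
by exists i; rewrite (lt_le_trans h)// /dinf; lra.
Qed.

Hypothesis P_dir : forall i j, exists k, forall f, P k f <= P i f /\ P k f <= P j f.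
Hypothesis P0 : forall i, P i 0 = 0.
Hypothesis P1 : forall i, P i 1 = 1.
Hypothesis PD : forall i f g, P i (f + g) <= Num.max (P i f) (P i g).
Hypothesis PM : forall i f g, exists k, P k (f * g) <= P i f * P i g.

(** Submultiplicativity is asked only up to a change of index ([PM]): the terms defining a
    localization multiply with their indices added. *)
Lemma dinf_seminorm : ring_seminorm dinf.
Proof.
split.
- exact: dinf_ge0.
- apply/eqP; rewrite eq_le dinf_ge0 andbT; apply: le_trans (dinf_le i0 _) _.
  by rewrite P0.
- apply/eqP; rewrite eq_le (le_trans (dinf_le i0 _)) ?P1//=.
  by apply: dinf_ge => i; rewrite P1.
- move=> f g; apply: le_mul_approx => [||a b]; try exact: dinf_ge0.
  move=> /dinf_lt[i ia] /dinf_lt[j jb].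
  have [k kij] := P_dir i j; have [l lk] := PM k f g.
  apply: le_trans (dinf_le l _) (le_trans lk _).
  have [ki _] := kij f; have [_ kj] := kij g.
  apply: ler_pM => //; first exact: le_trans ki (ltW ia).
  exact: le_trans kj (ltW jb).
- move=> f g; apply: le_of_ltr => a; rewrite gt_max.
  move=> /andP[/dinf_lt[i ia] /dinf_lt[j jb]].
  have [k kij] := P_dir i j.
  apply: le_trans (dinf_le k _) (le_trans (PD _ _ _) _).
  have [ki _] := kij f; have [_ kj] := kij g.
  by rewrite ge_max (le_trans ki (ltW ia)) (le_trans kj (ltW jb)).
Qed.

Lemma dinf_sqr f : (forall i, exists k, P k f * P k f <= P i (f * f)) ->
  dinf f * dinf f <= dinf (f * f).
Proof.
move=> h; apply: dinf_ge => i; have [k hk] := h i; apply: le_trans hk.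
by rewrite ler_pM ?dinf_ge0 ?dinf_le.
Qed.

Lemma dinf_mulr t f g : 0 <= t -> (forall i, t * P i f <= P i g) -> t * dinf f <= dinf g.
Proof.
move=> t0 h; apply: dinf_ge => i; apply: le_trans (h i).
by rewrite ler_wpM2l// dinf_le.
Qed.

End DirectedInf.

Definition sq_multiplicative p := forall f, p f * p f <= p (f * f).

(* multiplication by h has a bounded inverse, of norm at most 1/t *)
Definition bounded_below p h t := forall f, t * p f <= p (f * h).

Section Localize.
Variables (p : A -> R) (a : A).
Hypotheses (ps : ring_seminorm p) (psq : sq_multiplicative p) (pa : 0 < p a).

(** Repeated squaring gives the exponents 2^k; for general n, write a^(2^n) = a^(2^n - n) a^n and
    cancel the power of [p a]. *)
Lemma sq_multiplicativeX n : p (a ^+ n) = p a ^+ n.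
Proof.
apply/eqP; rewrite eq_le rsnX//=.
have pow2 k : p a ^+ (2 ^ k) <= p (a ^+ (2 ^ k)).
  elim: k => [|k IHk]; first by rewrite expn0 !expr1.
  rewrite expnS mul2n -addnn !exprD; apply: le_trans (psq _).
  by rewrite ler_pM// exprn_ge0// ltW.
have le_n : (n <= 2 ^ n)%N by rewrite ltnW// ltn_expl.
have := pow2 n; rewrite -(subnK le_n) !exprD => h.
have : p a ^+ (2 ^ n - n) * p a ^+ n <= p a ^+ (2 ^ n - n) * p (a ^+ n).
  apply: le_trans h (le_trans (rsnM ps _ _) _).
  by rewrite ler_wpM2r ?(rsn_ge0 ps)// rsnX.
by rewrite ler_pM2l// exprn_gt0.
Qed.

Let P n f := p (f * a ^+ n) / p a ^+ n.

Let pan n : 0 < p a ^+ n. Proof. exact: exprn_gt0. Qed.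

Let P_ge0 n f : 0 <= P n f.
Proof. by rewrite divr_ge0 ?(rsn_ge0 ps)// ltW. Qed.

(** The terms decrease with n ([P_ni]), so this is the limit of p(f a^n) / p(a)^n. It makes a
    multiplicative while keeping its value. *)
Definition localize := dinf P.

Let P_ni m n f : P (m + n)%N f <= P m f.
Proof.
rewrite /P ler_pdivrMr// mulrAC ler_pdivlMr// exprD mulrA.
rewrite [in leRHS]exprD [in leRHS]mulrA [leRHS]mulrAC ler_pM2r//.
by rewrite (le_trans (rsnM ps _ _))// ler_wpM2l ?(rsn_ge0 ps)// rsnX.
Qed.

Lemma localize_seminorm : ring_seminorm localize.
Proof.
apply: dinf_seminorm => //.
- exact: 0%N.
- move=> i j; exists (i + j)%N => f; split; first exact: P_ni.
  by rewrite addnC; exact: P_ni.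
- by move=> i; rewrite /P mul0r (rsn0 ps) mul0r.
- by move=> i; rewrite /P mul1r sq_multiplicativeX divff// gt_eqF.
- move=> i f g; rewrite /P mulrDl -maxr_pMl ?ler_pM2r ?invr_gt0//.
    exact: (rsnD ps).
  by rewrite invr_ge0 ltW.
- move=> i f g; exists (i + i)%N; rewrite /P mulf_div -exprD.
  rewrite ler_pM2r ?invr_gt0// exprD mulrACA.
  exact: (rsnM ps).
Qed.

Lemma localize_sq : sq_multiplicative localize.
Proof.
move=> f; apply: dinf_sqr => // [|i]; first exact: 0%N.
exists i; apply: le_trans (P_ni i i _).
by rewrite /P mulf_div -exprD ler_pM2r ?invr_gt0// exprD mulrACA.
Qed.

Lemma localize_le f : localize f <= p f.
Proof.
apply: le_trans (dinf_le 0%N P_ge0 0%N f) _.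
by rewrite /P !expr0 mulr1 divr1.
Qed.

Lemma localize_bounded_below h t : 0 <= t -> bounded_below p h t ->
  bounded_below localize h t.
Proof.
move=> t0 ht f; apply: dinf_mulr => // [|i]; first exact: 0%N.
by rewrite /P mulrA ler_pM2r ?invr_gt0// mulrAC.
Qed.

(** Multiplying f by a shifts the index: [P i (f * a)] equals [p a * P i.+1 f]. *)
Lemma localize_self : bounded_below localize a (p a).
Proof.
move=> f; apply: dinf_ge => [|i|i] //; first exact: 0%N.
rewrite /P -mulrA -exprS; apply: le_trans (_ : p a * P i.+1 f <= _).
  by rewrite ler_wpM2l ?(rsn_ge0 ps)//; apply: dinf_le => //; exact: 0%N.
by rewrite /P (exprS (p a)) mulrA -mulf_div divff ?mul1r ?gt_eqF.
Qed.

End Localize.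

(* Among the square-multiplicative seminorms below p, a minimal one is
   multiplicative, since it must agree with all its localizations. *)
Lemma ex_mseminorm p : ring_seminorm p -> sq_multiplicative p ->
  exists xi : mseminorm A R, (forall f, xi f <= p f) /\
    forall h (t : R), 0 <= t -> bounded_below p h t -> t <= xi h.
Proof.
move=> ps psq.
(* Lower bounds for multiplications are carried along: infima of chains and localizations preserve
   them, and evaluated at 1 they become lower bounds for values. *)
pose good q := [/\ ring_seminorm q, sq_multiplicative q, (forall f, q f <= p f)
  & forall h (t : R), 0 <= t -> bounded_below p h t -> bounded_below q h t].
have gp : good p by split.
pose T := {q | good q}.
(* The pointwise order is reversed, so that a maximal element for Zorn's lemma is a minimal
   seminorm. *)
pose leT (q1 q2 : T) := `[< forall f, sval q2 f <= sval q1 f >].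
have [|||C Ctot|[q gq] qmin] := @Zorn T leT.
- by move=> q; apply/asboolP => f.
- move=> q1 q2 q3 /asboolP h1 /asboolP h2; apply/asboolP => f.
  exact: le_trans (h2 f) (h1 f).
- move=> [q1 g1] [q2 g2] /asboolP h1 /asboolP h2; apply: eq_exist.
  by apply/funext => f; apply/eqP; rewrite eq_le h1 h2.
- have [[q0 Cq0]|C0] := pselect (exists q : T, C q); last first.
    by exists (exist _ _ gp) => q Cq; case: C0; exists q.
  pose I := {q | C q}; pose P (i : I) := sval (sval i).
  have gP i : good (P i) by exact: (svalP (sval i)).
  have P0 i f : 0 <= P i f by have [s _ _ _] := gP i; exact: (rsn_ge0 s).
  pose i0 : I := exist _ _ Cq0.
  have sP : ring_seminorm (dinf P).
    apply: dinf_seminorm => //.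
    + move=> [i Ci] [j Cj]; case: (Ctot i j Ci Cj) => /asboolP ij.
        by exists (exist _ _ Cj) => f; split => //; exact: ij.
      by exists (exist _ _ Ci) => f; split => //; exact: ij.
    + by move=> i; have [s _ _ _] := gP i; exact: (rsn0 s).
    + by move=> i; have [s _ _ _] := gP i; exact: (rsn1 s).
    + by move=> i f g; have [s _ _ _] := gP i; exact: (rsnD s).
    + by move=> i f g; exists i; have [s _ _ _] := gP i; exact: (rsnM s).
  have gI : good (dinf P).
    split => //.
    + move=> f; apply: dinf_sqr => // i; exists i.
      by have [_ s _ _] := gP i; exact: s.
    + move=> f; apply: le_trans (dinf_le i0 P0 i0 f) _.
      by have [_ _ s _] := gP i0; exact: s.
    + move=> h t t0 ht f; apply: dinf_mulr => // i.
      by have [_ _ _ s] := gP i; exact: s.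
  exists (exist _ _ gI) => q Cq; apply/asboolP => f /=.
  exact: (dinf_le i0 P0 (exist _ q Cq)).
have [qs qsq qp qh] := gq.
have qM f g : q (f * g) = q f * q g.
  apply/eqP; rewrite eq_le (rsnM qs)/=.
  have [->|gn0] := eqVneq (q g) 0; first by rewrite mulr0 (rsn_ge0 qs).
  have g0 : 0 < q g by rewrite lt_neqAle eq_sym gn0 (rsn_ge0 qs).
  have gl : good (localize q g).
    split.
    + exact: localize_seminorm.
    + exact: localize_sq.
    + by move=> k; apply: le_trans (localize_le qs g0 _) (qp _).
    + move=> h t t0 /(qh _ _ t0) ht; exact: localize_bounded_below.
  have := qmin (exist _ _ gl).
  have -> : leT (exist _ _ gq) (exist _ _ gl).
    by apply/asboolP => k /=; exact: localize_le.
  move=> /(_ isT) /(congr1 sval) /= ql.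
  by have := localize_self qs g0 f; rewrite ql mulrC.
have qD f g : q (f + g) <= q f + q g.
  rewrite (le_trans (rsnD qs _ _))// ge_max lerDl lerDr.
  by rewrite !(rsn_ge0 qs).
exists (MSeminorm (rsn_ge0 qs) (rsn0 qs) (rsn1 qs) qM qD); split => // h t t0 ht /=.
by have := qh _ _ t0 ht 1; rewrite mul1r (rsn1 qs) mulr1.
Qed.

End RingSeminorm.

(** * The spectral seminorm *)

Section SpectralSeminorm.
Variables (A : comNzRingType) (R : realType) (p : A -> R).
Hypothesis ps : ring_seminorm p.
Implicit Types (f g h : A) (s t : R).

(** Growth rates in place of n-th roots: estimates on products and sums become estimates on the
    constant C. *)
Let growth f s := 0 < s /\ exists C, forall n, p (f ^+ n) <= C * s ^+ n.

(* the limit of p (f ^+ n) ^ (1/n) *)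
Definition spectral f := inf [set s | growth f s].

Lemma growth_norm f s : p f < s -> growth f s.
Proof.
move=> fs; have f0 := rsn_ge0 ps f; have s0 : 0 < s by apply: le_lt_trans fs.
split=> //; exists 1 => n; rewrite mul1r (le_trans (rsnX _ _ ps))//.
by rewrite lerXn2r ?nnegrE// ltW.
Qed.

Let has_inf_growth f : has_inf [set s | growth f s].
Proof.
split; first by exists (p f + 1); apply: growth_norm; rewrite ltrDl.
by exists 0 => s [/ltW].
Qed.

Lemma spectral_ge0 f : 0 <= spectral f.
Proof. by apply: lb_le_inf; [case: (has_inf_growth f)|move=> s [/ltW]]. Qed.

Lemma spectral_le f s : growth f s -> spectral f <= s.
Proof. by move=> fs; apply: ge_inf => //; case: (has_inf_growth f). Qed.

Lemma spectral_ge f x : (forall s, growth f s -> x <= s) -> x <= spectral f.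
Proof. by move=> h; apply: lb_le_inf; [case: (has_inf_growth f)|]. Qed.

Lemma spectral_lt f s : spectral f < s -> growth f s.
Proof.
move=> fs; have d0 : 0 < s - spectral f by rewrite subr_gt0.
have [t [t0 [C hC]]] := inf_adherent d0 (has_inf_growth f).
rewrite -/(spectral f) addrC subrK => ts; have s0 := lt_trans t0 ts.
have C0 : 0 <= C by have := hC 0%N; rewrite expr0 (rsn1 ps) mulr1; lra.
split=> //; exists C => n; apply: le_trans (hC n) _.
by rewrite ler_wpM2l// lerXn2r ?nnegrE// ltW.
Qed.

Lemma spectral_le_norm f : spectral f <= p f.
Proof. by apply: le_of_ltr => s /growth_norm/spectral_le. Qed.

(** By multiplicativity xi(f)^n = xi(f^n) <= C D s^n for any growth rate s of f, and the constants
    disappear as n grows. *)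
Lemma mseminorm_le_spectral (xi : mseminorm A R) C f :
  (forall g, xi g <= C * p g) -> xi f <= spectral f.
Proof.
move=> xip; apply: spectral_ge => s [s0 [D hD]].
have C0 : 0 <= C.
  by have := xip 1; rewrite msn1 (rsn1 ps); lra.
apply: (@le_of_expr_le _ _ _ (C * D)) => [||n].
- exact: msn_ge0.
- exact: ltW.
- rewrite -msnX (le_trans (xip _))// -mulrA ler_wpM2l//.
Qed.

Lemma spectral_seminorm : ring_seminorm spectral.
Proof.
have s1 : spectral 1 = 1.
  apply/eqP; rewrite eq_le (le_trans (spectral_le_norm _)) ?(rsn1 ps)//=.
  apply: spectral_ge => s [s0 [C hC]].
  apply: (@le_of_expr_le _ _ _ C) => // [|n]; first exact: ltW.
  by rewrite expr1n -(rsn1 ps) -[X in p X](expr1n _ n).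
split=> //.
- exact: spectral_ge0.
- apply/eqP; rewrite eq_le spectral_ge0 (le_trans (spectral_le_norm _))//.
  by rewrite (rsn0 ps).
- move=> f g; apply: le_mul_approx => [||a b]; try exact: spectral_ge0.
  move=> /spectral_lt[a0 [C hC]] /spectral_lt[b0 [D hD]].
  apply: spectral_le; split; first exact: mulr_gt0.
  exists (C * D) => n; rewrite !exprMn mulrACA (le_trans (rsnM ps _ _))//.
  by rewrite ler_pM ?(rsn_ge0 ps).
- move=> f g; apply: le_of_ltr => a; rewrite gt_max => /andP[].
  move=> /spectral_lt[a0 [C hC]] /spectral_lt[_ [D hD]].
  apply: spectral_le; split => //; exists (C * D) => n.
  (* In the binomial expansion the integer coefficients are harmless by [rsnMn], and each product of
     powers is at most C D a^n. *)
  rewrite exprDn; apply: rsn_sum => // [|i _].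
    have C0 : 0 <= C by have := hC 0%N; rewrite !expr0 (rsn1 ps) mulr1; lra.
    have D0 : 0 <= D by have := hD 0%N; rewrite !expr0 (rsn1 ps) mulr1; lra.
    by rewrite !mulr_ge0// exprn_ge0// ltW.
  apply: le_trans (rsnMn _ _ ps) _.
  have le_in : (i <= n)%N by rewrite -ltnS.
  rewrite -[in leRHS](subnK le_in) exprD mulrACA (le_trans (rsnM ps _ _))//.
  by rewrite ler_pM ?(rsn_ge0 ps).
Qed.

Lemma spectral_sq : sq_multiplicative spectral.
Proof.
move=> f; apply: spectral_ge => s [s0 [C hC]].
have r0 : 0 < Num.sqrt s by rewrite sqrtr_gt0.
have rs : Num.sqrt s * Num.sqrt s = s by rewrite -expr2 sqr_sqrtr// ltW.
have C0 : 0 <= C by have := hC 0%N; rewrite !expr0 (rsn1 ps) mulr1; lra.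
suff fr : spectral f <= Num.sqrt s.
  by rewrite -[leRHS]rs ler_pM// spectral_ge0.
(* Even exponents use the constant C; the second summand pays for the extra factor f of an odd
   exponent. *)
apply: spectral_le; split => //; exists (C + p f * C / Num.sqrt s) => n.
have h m : p (f ^+ m.*2) <= C * Num.sqrt s ^+ m.*2.
  by rewrite -mul2n !exprM !expr2 rs.
have f0 : 0 <= p f * C by rewrite mulr_ge0// (rsn_ge0 ps).
rewrite -[n]odd_double_half; case: (odd n) => /=; last first.
  rewrite add0n (le_trans (h _))// mulrDl lerDl.
  by rewrite mulr_ge0 ?divr_ge0// ?exprn_ge0// ltW.
rewrite add1n !exprS (le_trans (rsnM ps _ _))// mulrDl ler_wpDl//.
  by rewrite !mulr_ge0 ?exprn_ge0// ltW.
by rewrite mulrA mulfVK ?gt_eqF// -mulrA ler_wpM2l// (rsn_ge0 ps).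
Qed.

(** Iterating the bound gives t^n p(f^n) <= p((f h)^n), so a growth rate s of f h yields the growth
    rate s/t of f. *)
Lemma spectral_bounded_below h t : 0 <= t -> bounded_below p h t ->
  bounded_below spectral h t.
Proof.
rewrite le_eqVlt => /orP[/eqP <- _ f|t0 ht f].
  by rewrite mul0r spectral_ge0.
have hX n k : t ^+ n * p k <= p (k * h ^+ n).
  elim: n => [|n IHn]; first by rewrite !expr0 mul1r mulr1.
  rewrite exprSr exprSr mulrA (le_trans _ (ht _))// -mulrA mulrCA.
  by rewrite ler_pM2l.
apply: spectral_ge => s [s0 [C hC]].
rewrite mulrC -ler_pdivlMr//; apply: spectral_le; split.
  exact: divr_gt0.
exists C => n; rewrite expr_div_n mulrA ler_pdivlMr ?exprn_gt0//.
by rewrite (le_trans _ (hC n))// exprMn mulrC.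
Qed.

(* The maximum modulus principle for the Berkovich spectrum of (A, p), away
   from the zeros of an element h which is not a topological divisor of zero. *)
Lemma ex_peak_point f h t : 0 <= t -> bounded_below p h t ->
  exists xi : mseminorm A R,
    [/\ forall g, xi g <= p g, xi f = spectral f & t <= xi h].
Proof.
move=> t0 /(spectral_bounded_below t0) ht.
have [f0|fn0] := eqVneq (spectral f) 0.
  have [xi [xip xit]] := ex_mseminorm spectral_seminorm spectral_sq.
  exists xi; split; last exact: xit.
    by move=> g; rewrite (le_trans (xip g))// spectral_le_norm.
  by apply/eqP; rewrite eq_le xip f0 msn_ge0.
have fp : 0 < spectral f by rewrite lt_neqAle eq_sym fn0 spectral_ge0.
(* After localization at f, multiplication by f is bounded below by [spectral f], which forces xi f
   >= [spectral f]. *)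
have [xi [xip xit]] := ex_mseminorm (localize_seminorm spectral_seminorm spectral_sq fp)
  (localize_sq spectral_seminorm spectral_sq fp).
have xis g : xi g <= spectral g.
  by apply: le_trans (xip g) (localize_le spectral_seminorm fp g).
exists xi; split.
- by move=> g; rewrite (le_trans (xis g))// spectral_le_norm.
- apply/eqP; rewrite eq_le xis xit// ?spectral_ge0//.
  exact: localize_self spectral_seminorm fp.
- by apply: xit => //; exact: (localize_bounded_below spectral_seminorm fp).
Qed.

End SpectralSeminorm.

(** * The Gauss norm *)

Section TateNorm.
Variables (R : realType) (K : fieldType) (v : complete_nonarch_abs R K).
Variables (M : zmodType) (omega : {additive M -> R}).
Local Notation T := (tate v omega).
Local Notation N := (@tate_norm _ _ v _ omega).
Local Notation W u := (expR (- omega u)).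
Implicit Types (a b : T) (u : M).

Let has_sup_tate a : has_sup (range (fun u => v (a u) * W u)).
Proof.
split; first by exists (v (a 0) * W 0); exists 0.
have [|C _ hC] := @vanishing_bounded _ _ (fun u => v (a u) * W u) _ (tcoefP a).
  by move=> u; rewrite mulr_ge0 ?nabs_ge0// expR_ge0.
by exists C => _ [u _ <-].
Qed.

Lemma coef_le_tate_norm a u : v (a u) * W u <= N a.
Proof. by apply: ub_le_sup; [case: (has_sup_tate a)|exists u]. Qed.

Lemma tate_norm_le a x : (forall u, v (a u) * W u <= x) -> N a <= x.
Proof. by move=> h; apply: ge_sup; [case: (has_sup_tate a)|move=> _ [u _ <-]]. Qed.

Lemma tate_norm_seminorm : ring_seminorm N.
Proof.
have W0 u : 0 < W u by exact: expR_gt0.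
have WD u t : W (u + t) = W u * W t by rewrite raddfD opprD expRD.
have N0 a : 0 <= N a.
  by apply: le_trans (coef_le_tate_norm a 0); rewrite mulr_ge0 ?nabs_ge0// ltW.
have c0 u : (0 : T) u = 0 by rewrite /= monomialE if_same.
have c1 u : (1 : T) u = if u == 0 then 1 else 0 by rewrite /= monomialE.
split => //.
- apply/eqP; rewrite eq_le N0 andbT; apply: tate_norm_le => u.
  by rewrite c0 nabs0 mul0r.
- apply/eqP; rewrite eq_le; apply/andP; split.
    apply: tate_norm_le => u; rewrite c1; case: eqP => [->|_].
      by rewrite nabs1 raddf0 oppr0 expR0 mulr1.
    by rewrite nabs0 mul0r.
  apply: le_trans (coef_le_tate_norm _ 0).
  by rewrite c1 eqxx nabs1 raddf0 oppr0 expR0 mulr1.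
- move=> a b; apply: tate_norm_le => w.
  apply: le_of_ltr => e abe; have e0 : 0 < e by apply: le_lt_trans abe; rewrite mulr_ge0.
  rewrite -ler_pdivlMr//; apply/ltW/usum_lt; first exact: tate_mul_null.
    exact: divr_gt0.
  move=> u; rewrite ltr_pdivlMr//; apply: le_lt_trans abe.
  have -> : W w = W u * W (w - u) by rewrite -WD addrC subrK.
  by rewrite nabsM mulrACA ler_pM ?coef_le_tate_norm// mulr_ge0 ?nabs_ge0// ltW.
- move=> a b; apply: tate_norm_le => u.
  apply: (@le_trans _ _ (Num.max (v (a u)) (v (b u)) * W u)).
    by rewrite ler_pM2r// nabsD.
  rewrite maxr_pMl ?(ltW (W0 _))// ge_max !le_max !coef_le_tate_norm.
  by rewrite orbT.
Qed.

(** Keep the finitely many terms of a whose weight is at least e. *)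
Lemma tate_approx a e : 0 < e ->
  exists f, N (a - tate_of_group_ring v omega f) <= e.
Proof.
move=> e0; have /finite_fsetP[S hS] := tcoefP a e0.
exists ([fsfun u in S => a u] : {fsfun M -> K with 0}); apply: tate_norm_le => u.
have -> : (a - tate_of_group_ring v omega [fsfun u in S => a u]) u =
    a u - (if u \in S then a u else 0) by rewrite /= /gr_coef fsfunE.
case: ifPn => [_|uS]; first by rewrite subrr nabs0 mul0r ltW.
rewrite subr0 ltW// ltNge; apply: contra uS => ue.
by have : [set` S] u by rewrite -hS.
Qed.

Lemma tate_normN a : N (- a) = N a.
Proof.
by congr sup; apply/seteqP; split => _ [u _ <-]; exists u => //=; rewrite nabsN.
Qed.

Lemma tate_normB a b : N (a - b) <= Num.max (N a) (N b).
Proof. by rewrite -(tate_normN b) (rsnD tate_norm_seminorm). Qed.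

Lemma tate_norm_monomial (c : K) u :
  N (tate_of_group_ring v omega (monomial c u)) = v c * W u.
Proof.
apply/eqP; rewrite eq_le; apply/andP; split.
  apply: tate_norm_le => w /=; rewrite monomialE; case: eqP => [->//|_].
  by rewrite nabs0 mul0r mulr_ge0 ?nabs_ge0// expR_ge0.
apply: le_trans (coef_le_tate_norm _ u).
by rewrite /= monomialE eqxx.
Qed.

End TateNorm.

(** * Groebner bases for the Gauss norm *)

Lemma ex_maximum (T : eqType) (lt : T -> T -> Prop) (s : seq T) :
  (forall x y z, lt x y -> lt y z -> lt x z) ->
  (forall x y, x != y -> lt x y \/ lt y x) -> s != [::] ->
  exists2 m, m \in s & forall x, x \in s -> x != m -> lt x m.
Proof.
move=> ltT ltt; elim: s => // x [_ _|y s IHs _].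
  exists x; first by rewrite inE.
  by move=> z; rewrite inE => /eqP ->; rewrite eqxx.
have [m ms mmax] := IHs isT.
have [xm|xm] := eqVneq x m.
  exists m; first by rewrite inE ms orbT.
  by move=> z; rewrite inE xm => /orP[/eqP ->|/mmax//]; rewrite eqxx.
have [xm'|mx] := ltt _ _ xm.
  exists m; first by rewrite inE ms orbT.
  by move=> z; rewrite inE => /orP[/eqP -> //|/mmax].
exists x; first by rewrite inE eqxx.
move=> z; rewrite inE => /orP[/eqP ->|zs _]; first by rewrite eqxx.
by have [->//|/(mmax _ zs) zm] := eqVneq z m; exact: ltT zm mx.
Qed.

(* Dickson's lemma for N^k, the vectors being the restrictions to [0, k) of
   functions on nat. *)
Lemma dickson k (L : set (nat -> nat)) : exists E : set (nat -> nat),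
  [/\ finite_set E, E `<=` L &
    forall c, L c -> exists2 e, E e & forall i, (i < k)%N -> (e i <= c i)%N].
Proof.
elim: k L => [|k IHk] L.
  have [[c Lc]|L0] := pselect (exists c, L c).
    exists [set c]; split; first exact: finite_set1.
      by move=> _ ->.
    by move=> d _; exists c.
  exists set0; split=> //.
  by move=> c Lc; case: L0; exists c.
have [E [Efin EL Edom]] := IHk L.
(* Vectors whose last coordinate is at least n0 are dominated by E; those below n0 fall into
   finitely many slices, treated by induction. *)
have [n0 hn0] : exists n0, forall e, E e -> (e k < n0)%N.
  have /finite_fsetP[S hS] := finite_image (fun e : nat -> nat => e k) Efin.
  exists (\sum_(i <- S) i).+1 => e Ee; rewrite ltnS.
  have : [set` S] (e k) by rewrite -hS; exists e.
  by move=> /= eS; rewrite (big_fsetD1 _ eS)/= leq_addr.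
have [F hF] := choice (fun n => IHk (L `&` [set c | c k = n])).
exists (E `|` \bigcup_(n in `I_n0) F n); split.
- rewrite finite_setU; split=> //; apply: bigcup_finite; first exact: finite_II.
  by move=> n _; have [] := hF n.
- move=> c [/EL//|[n _ Fc]].
  by have [_ /(_ _ Fc)[]] := hF n.
- move=> c Lc; have [ck|ck] := ltnP (c k) n0.
    have [_ FL Fdom] := hF (c k).
    have [|e Fe ec] := Fdom c; first by split.
    exists e; first by right; exists (c k).
    move=> i; rewrite ltnS leq_eqVlt => /orP[/eqP ->|/ec//].
    by have [_ /= ->] := FL _ Fe.
  have [e Ee ec] := Edom c Lc; exists e; first by left.
  move=> i; rewrite ltnS leq_eqVlt => /orP[/eqP ->|/ec//].
  by rewrite (leq_trans _ ck)// ltnW// hn0.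
Qed.

(* A translation-invariant total order on Z^r, given by its positive cone. *)
Definition lex_pos r (x : 'rV[int]_r) :=
  exists j, 0 < x 0 j /\ forall i : 'I_r, (i < j)%N -> x 0 i = 0.

Lemma lex_posD r (x y : 'rV[int]_r) : lex_pos x -> lex_pos y -> lex_pos (x + y).
Proof.
move=> [i [xi x0]] [j [yj y0]]; have [ij|ji|/val_inj ij] := ltngtP i j.
- exists i; rewrite mxE (y0 _ ij) addr0; split => // k ki.
  by rewrite mxE x0 ?y0 ?addr0// (ltn_trans ki).
- exists j; rewrite mxE (x0 _ ji) add0r; split => // k kj.
  by rewrite mxE x0 ?y0 ?addr0// (ltn_trans kj).
- subst j; exists i; rewrite mxE addr_gt0//; split => // k ki.
  by rewrite mxE x0 ?y0 ?addr0.
Qed.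

Lemma lex_pos_total r (x : 'rV[int]_r) : x != 0 -> lex_pos x \/ lex_pos (- x).
Proof.
move=> x0; have [j0 xj0] : exists j, x 0 j != 0.
  apply/existsP; apply: contra_neqT x0; rewrite negb_exists => /forallP x0.
  by apply/rowP => j; rewrite mxE; apply/eqP; rewrite -[_ == _]negbK x0.
have [j xj jmin] := @arg_minnP _ j0 (fun j => x 0 j != 0) (fun j => val j) xj0.
have xi0 (i : 'I_r) : (i < j)%N -> x 0 i = 0.
  by move=> ij; apply/eqP; apply: contraLR ij => /jmin; rewrite -leqNgt.
case: (ltgtP (x 0 j) 0) xj => // xj _; [right|left]; exists j; split => //.
- by rewrite mxE oppr_gt0.
- by move=> i /xi0; rewrite mxE => ->; rewrite oppr0.
Qed.

Section GroupRingCoef.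
Variables (K : fieldType) (M : zmodType).
Implicit Types (f g : group_ring K M).

Lemma gr_coefD f g u : gr_coef (f + g) u = gr_coef f u + gr_coef g u.
Proof. exact: gr_addE. Qed.

Lemma gr_coefN f u : gr_coef (- f) u = - gr_coef f u.
Proof. exact: gr_oppE. Qed.

Lemma gr_coefB f g u : gr_coef (f - g) u = gr_coef f u - gr_coef g u.
Proof. by rewrite gr_coefD gr_coefN. Qed.

Lemma gr_coef0 u : gr_coef (0 : group_ring K M) u = 0.
Proof. by rewrite monomialE if_same. Qed.

Lemma gr_coef_monomialM c u f w :
  gr_coef (monomial c u * f) w = c * gr_coef f (w - u).
Proof.
rewrite [LHS](@gr_mulE_sub _ _ _ _ [fset u]%fset); last first.
  apply/fsubsetP => s; rewrite inE; apply: contraLR => su.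
  by rewrite mem_finsupp negbK fsfunE inE (negbTE su).
by rewrite big_seq_fset1 monomialE eqxx.
Qed.

Lemma gr_neq0P f : f != 0 -> exists u, gr_coef f u != 0.
Proof.
move=> f0; apply: contrapT => h; move/eqP: f0; apply; apply: gr_eqP => u.
rewrite gr_coef0; apply/eqP/negP => /negP fu; by apply: h; exists u.
Qed.

End GroupRingCoef.

Section StrictGenerators.
Variables (R : realType) (K : fieldType) (v : complete_nonarch_abs R K).
Variables (M : zmodType) (omega : {additive M -> R}).
Local Notation KM := (group_ring K M).
Local Notation N f := (tate_norm (tate_of_group_ring v omega f)).
Local Notation W u := (expR (- omega u)).
Implicit Types (f g p q s x y : KM) (u w : M).

Lemma coef_le_gauss f u : v (gr_coef f u) * W u <= N f.
Proof. exact: (coef_le_tate_norm (tate_of_group_ring v omega f)). Qed.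

Lemma gauss_le f c : (forall u, v (gr_coef f u) * W u <= c) -> N f <= c.
Proof. exact: (@tate_norm_le _ _ v _ omega (tate_of_group_ring v omega f)). Qed.

Lemma gauss_ge0 f : 0 <= N f.
Proof. exact: rsn_ge0 (tate_norm_seminorm v omega) _. Qed.

Lemma gauss_seminorm : ring_seminorm (fun f => N f).
Proof.
have NS := tate_norm_seminorm v omega; split.
- by move=> f; exact: rsn_ge0 NS _.
- by rewrite rmorph0 (rsn0 NS).
- by rewrite rmorph1 (rsn1 NS).
- by move=> f g; rewrite rmorphM (rsnM NS).
- by move=> f g; rewrite rmorphD (rsnD NS).
Qed.

Lemma gauss_monomialM c u f : N (monomial c u * f) <= v c * W u * N f.
Proof. by rewrite (le_trans (rsnM gauss_seminorm _ _))// tate_norm_monomial. Qed.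

Let W_gt0 u : 0 < W u. Proof. exact: expR_gt0. Qed.

Let WD u w : W (u + w) = W u * W w.
Proof. by rewrite raddfD opprD expRD. Qed.

Variables (r : nat) (phi : {additive 'rV[int]_r -> M}) (psi : M -> 'rV[int]_r).
Hypotheses (phiK : cancel phi psi) (psiK : cancel psi phi).

Let psiD u w : psi (u + w) = psi u + psi w.
Proof. by rewrite -{1}[u]psiK -{1}[w]psiK -raddfD phiK. Qed.

Let psi0 : psi 0 = 0.
Proof. by rewrite -(raddf0 phi) phiK. Qed.

Let psiN u : psi (- u) = - psi u.
Proof. by apply/eqP; rewrite -addr_eq0 -psiD addNr psi0. Qed.

Let pos u := lex_pos (psi u).

Let posD u w : pos u -> pos w -> pos (u + w).
Proof. by rewrite /pos psiD; exact: lex_posD. Qed.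

Let pos_total u : u != 0 -> pos u \/ pos (- u).
Proof.
move=> u0; rewrite /pos psiN; apply: lex_pos_total; apply: contra_neq u0 => h.
by rewrite -[u]psiK h raddf0.
Qed.

(* the leading exponent for the weight v(f_u) exp(- omega u), with ties broken
   by the lexicographic order *)
Let leading f u := gr_coef f u != 0 /\ forall w, pos (w - u) ->
  v (gr_coef f w) * W w < v (gr_coef f u) * W u.

(** Take the largest exponent of the support, ordered by weight and then lexicographically.
    [leading] compares u only with larger exponents; the equation for the norm adds that its weight
    is maximal. *)
Let ex_leading f : f != 0 ->
  exists2 u, leading f u & N f = v (gr_coef f u) * W u.
Proof.
move=> f0; pose key u := v (gr_coef f u) * W u.
pose lt u w := key u < key w \/ key u = key w /\ pos (w - u).
have S0 : (gr_supp f : seq M) != [::].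
  have [u fu] := gr_neq0P f0.
  have : u \in gr_supp f by rewrite mem_finsupp.
  by apply: contraTneq => h; rewrite -[_ \in _]/(u \in enum_fset _) h.
have [||u uf umax] := @ex_maximum _ lt _ _ _ S0.
- move=> x y z; rewrite /lt => -[xy|[xy pxy]] [yz|[yz pyz]].
  + by left; exact: lt_trans yz.
  + by left; rewrite -yz.
  + by left; rewrite xy.
  + right; split; first by rewrite xy.
    by have := posD pyz pxy; rewrite addrA subrK.
- move=> x y xy; rewrite /lt; case: (ltgtP (key x) (key y)) => h; first by left; left.
    by right; left.
  have [||] := @pos_total (x - y); first by rewrite subr_eq0.
    by right; right.
  by rewrite opprB; left; right.
have fu : gr_coef f u != 0 by move: uf; rewrite mem_finsupp.
have key0 w : w \notin gr_supp f -> key w = 0.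
  by rewrite /key => /gr_coef_out ->; rewrite nabs0 mul0r.
have keyu : 0 < key u by rewrite /key mulr_gt0 ?nabs_gt0.
have not_pos w : pos w -> pos (- w) -> False.
  move=> pw nw; have := posD pw nw; rewrite subrr /pos psi0 => -[j].
  by rewrite mxE ltxx => -[].
exists u.
  split=> // w wu; rewrite -/(key w) -/(key u).
  have [wf|/key0 -> //] := boolP (w \in gr_supp f).
  have wu' : w != u.
    apply: contraPneq wu => ->; rewrite subrr /pos psi0 => -[j].
    by rewrite mxE ltxx => -[].
  have [//|[_ uw]] := umax _ wf wu'.
  by case: (not_pos _ wu); rewrite opprB.
apply/eqP; rewrite eq_le coef_le_gauss andbT; apply: gauss_le => w.
rewrite -/(key w) -/(key u).
have [wf|/key0 ->] := boolP (w \in gr_supp f); last exact: ltW.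
have [->//|wu] := eqVneq w u.
by have [/ltW//|[-> _]] := umax _ wf wu.
Qed.

Variables (J : set KM) (J_ideal : is_ideal J).

Let J0 : J 0. Proof. by case: J_ideal. Qed.
Let JD f g : J f -> J g -> J (f + g). Proof. by case: J_ideal => _ h _; exact: h. Qed.
Let JM f g : J g -> J (f * g). Proof. by case: J_ideal => _ _; apply. Qed.
Let JB f g : J f -> J g -> J (f - g).
Proof. by move=> Jf Jg; apply: JD => //; rewrite -mulN1r; exact: JM. Qed.

(** Elements of J translated and scaled so that their leading term is 1; characters being units,
    every leading exponent can be moved to 0. *)
Let monic p := [/\ J p, gr_coef p 0 = 1, N p <= 1 &
  forall u, pos u -> v (gr_coef p u) * W u < 1].

(* the coordinates of the exponents of p lie in the box
   prod_j [- d j, d (r + j)] *)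
Let fits p (d : nat -> nat) := forall u, gr_coef p u != 0 ->
  forall j : 'I_r, - (d j)%:Z <= psi u 0 j <= (d (r + j)%N)%:Z.

(** The image in J, when ps consists of elements of J, of the ball of radius c of the free module on
    ps. *)
Let ball (ps : seq KM) c := [set x | exists g : KM -> KM,
  x = \sum_(p <- ps) g p * p /\ forall p, N (g p) <= c].

Let ballD ps c x y : ball ps c x -> ball ps c y -> ball ps c (x + y).
Proof.
move=> [g [-> gc]] [h [-> hc]]; exists (fun p => g p + h p); split.
  by rewrite -big_split; apply: eq_bigr => p _; rewrite mulrDl.
by move=> p; rewrite (le_trans (rsnD gauss_seminorm _ _))// ge_max gc hc.
Qed.

Let ballM ps c a u x : ball ps c x -> ball ps (v a * W u * c) (monomial a u * x).
Proof.
move=> [g [-> gc]]; exists (fun p => monomial a u * g p); split.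
  by rewrite mulr_sumr; apply: eq_bigr => p _; rewrite mulrA.
move=> p; rewrite (le_trans (gauss_monomialM _ _ _))// ler_wpM2l//.
by rewrite mulr_ge0 ?nabs_ge0// ltW.
Qed.

Let ball_le ps c d x : c <= d -> ball ps c x -> ball ps d x.
Proof.
move=> cd [g [-> gc]]; exists g; split=> // p; exact: le_trans (gc p) cd.
Qed.

Let ball0 ps c : 0 <= c -> ball ps c 0.
Proof.
move=> c0; exists (fun=> 0); split.
  by rewrite big1// => p _; rewrite mul0r.
by move=> p; rewrite (rsn0 gauss_seminorm).
Qed.

Let ball_mem ps p : p \in ps -> ball (undup ps) 1 p.
Proof.
move=> pps; exists (fun q => if q == p then 1 else 0); split.
  rewrite (bigD1_seq p) ?mem_undup ?undup_uniq//= eqxx mul1r big1 ?addr0//.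
  by move=> q /negbTE ->; rewrite mul0r.
by move=> q; case: ifP; rewrite ?(rsn1 gauss_seminorm) ?(rsn0 gauss_seminorm).
Qed.

Let ball_norm ps c x : 0 <= c -> (forall p, p \in ps -> N p <= 1) ->
  ball ps c x -> N x <= c.
Proof.
move=> c0 ps1 [g [-> gc]]; apply: (rsn_sum gauss_seminorm) => // p pps.
rewrite (le_trans (rsnM gauss_seminorm _ _))// -[leRHS]mulr1.
by rewrite ler_pM ?gauss_ge0// ps1.
Qed.

Section Elimination.
Variables (B : R -> set KM) (q : M -> KM) (U : {fset M}).
Hypothesis BD : forall c x y, B c x -> B c y -> B c (x + y).
Hypothesis BZ : forall c a x, B c x -> B (v a * c) (monomial a 0 * x).
Hypothesis B_le : forall c d x, c <= d -> B c x -> B d x.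
Hypothesis B0 : forall c, 0 <= c -> B c 0.
Hypothesis BN : forall c x, 0 <= c -> B c x -> N x <= c.
Hypothesis Bq : forall u, u \in U -> B (W u) (q u).
Hypothesis q1 : forall u, u \in U -> gr_coef (q u) u = 1.
Hypothesis q_lt : forall u w, u \in U -> pos (w - u) ->
  v (gr_coef (q u) w) * W w < W u.

(* The matrix of the coefficients of the q_u is, after scaling, unitriangular
   modulo the maximal ideal; Gaussian elimination adds the exponents of U in
   increasing order. *)
Let eliminate s : exists x, [/\ B (N s) x,
  forall u, u \in U -> gr_coef (s - x) u = 0 &
  forall w, (forall u, u \in U -> pos (w - u)) -> 0 < N s ->
    v (gr_coef x w) * W w < N s].
Proof.
(* The third property is the invariant that keeps the next pivot a unit; s is generalized since
   induction is applied to both s and [q m]. *)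
suff H n (V : {fset M}) : (V `<=` U)%fset -> #|` V| = n -> forall s,
    exists x, [/\ B (N s) x,
      forall u, u \in V -> gr_coef (s - x) u = 0 &
      forall w, (forall u, u \in V -> pos (w - u)) -> 0 < N s ->
        v (gr_coef x w) * W w < N s] by exact: (H _ U).
elim: n V => [|n IHn] V VU Vn {}s.
  have V0 : V = fset0 by apply/eqP; rewrite -cardfs_eq0 Vn.
  exists 0; split; first by apply/B0/gauss_ge0.
    by move=> u; rewrite V0.
  by move=> w _ s0; rewrite gr_coef0 nabs0 mul0r.
have [|||m mV mmax] := @ex_maximum _ (fun u w => pos (w - u)) (V : seq M).
- by move=> u w z uw wz; have := posD wz uw; rewrite addrA subrK.
- move=> u w uw; rewrite -(opprB u w); apply/or_comm/pos_total.
  by rewrite subr_eq0.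
- apply: contra_eqN Vn => /eqP V0.
  by rewrite -[#|` V|]/(size (enum_fset V)) V0.
have mU := fsubsetP VU _ mV.
pose V' := (V `\ m)%fset.
have V'V u : u \in V' -> u \in V /\ u != m by rewrite in_fsetD1 => /andP[-> ->].
have V'U : (V' `<=` U)%fset by apply: fsubset_trans VU; exact: fsubD1set.
have V'n : #|` V'| = n by move: Vn; rewrite (cardfsD1 m) mV => -[].
have [x [Bx xs x_lt]] := IHn _ V'U V'n s.
have [y [By yq y_lt]] := IHn _ V'U V'n (q m).
have Nq : N (q m) = W m.
  apply/eqP; rewrite eq_le (BN (ltW (W_gt0 m)) (Bq mU))/=.
  by have := coef_le_gauss (q m) m; rewrite q1// nabs1 mul1r.
have Wm := W_gt0 m; rewrite Nq in By y_lt.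
have mV' u : u \in V' -> pos (m - u) by move=> /V'V[uV um]; exact: mmax.
(* z has no coefficient at the smaller exponents of V, and its coefficient at m still has absolute
   value 1, since that of y is smaller. *)
pose z := q m - y.
have zm : v (gr_coef z m) = 1.
  have ym : v (gr_coef y m) < 1.
    by have := y_lt m mV' Wm; rewrite -[ltRHS]mul1r ltr_pM2r.
  rewrite gr_coefB q1//; apply/eqP; rewrite eq_le; apply/andP; split.
    by rewrite (le_trans (nabsD _ _ _))// nabs1 nabsN ge_max lexx ltW.
  rewrite leNgt; apply/negP => h; have := nabsD_lt h ym.
  by rewrite subrK nabs1 ltxx.
have zm0 : gr_coef z m != 0.
  by apply: contra_eq_neq zm => ->; rewrite nabs0 eq_sym oner_eq0.
have Bz : B (W m) z.
  apply: BD; first exact: Bq.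
  have := BZ (-1) By; rewrite nabsN nabs1 mul1r.
  suff -> : monomial (-1) 0 * y = - y by [].
  by apply: gr_eqP => u; rewrite gr_coef_monomialM gr_coefN subr0 mulN1r.
(* Subtracting t z clears the exponent m. The pivot has absolute value 1, so t z costs no more than
   [N s]. *)
pose t := gr_coef (s - x) m / gr_coef z m.
have tm : v t * W m <= N s.
  rewrite /t nabsM.
  have -> : v (gr_coef z m)^-1 = 1.
    by rewrite -[LHS]mul1r -{1}zm -nabsM divff ?nabs1.
  rewrite mulr1 gr_coefB.
  apply: le_trans (_ : Num.max (v (gr_coef s m)) (v (gr_coef x m)) * W m <= _).
    by rewrite ler_pM2r// -(nabsN v (gr_coef x m)) nabsD.
  rewrite maxr_pMl ?(ltW Wm)// ge_max coef_le_gauss/=.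
  by rewrite (le_trans (coef_le_gauss _ _))// BN// gauss_ge0.
exists (x + monomial t 0 * z); split.
- by apply: BD => //; apply: B_le tm _; exact: BZ.
- move=> u uV; rewrite opprD addrA gr_coefB gr_coef_monomialM subr0.
  have [->|um] := eqVneq u m; first by rewrite divfK ?subrr.
  have uV' : u \in V' by rewrite in_fsetD1 um.
  by rewrite xs// yq// mulr0 subr0.
- move=> w wV s0; have wV' u : u \in V' -> pos (w - u) by move=> /V'V[/wV].
  rewrite gr_coefD gr_coef_monomialM subr0 -ltr_pdivlMr//.
  apply: nabsD_lt; first by rewrite ltr_pdivlMr// x_lt.
  rewrite ltr_pdivlMr// nabsM -mulrA.
  have [->|t0] := eqVneq t 0; first by rewrite nabs0 mul0r.
  apply: lt_le_trans tm; rewrite ltr_pM2l ?nabs_gt0//.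
  rewrite -ltr_pdivlMr// gr_coefB; apply: nabsB_lt; rewrite ltr_pdivlMr//.
    by apply: q_lt => //; exact: wV.
  exact: y_lt.
Qed.

(** To be applied with U the set of all leading exponents available in a cube, so that the remainder
    has no room for a leading exponent. *)
Lemma elimination s : exists2 x, B (N s) x & forall u, u \in U -> gr_coef (s - x) u = 0.
Proof. by have [x [? ? _]] := eliminate s; exists x. Qed.

End Elimination.

Let in_cube (b : nat) u := forall j : 'I_r, `|psi u 0 j| <= b%:Z.
Let supp_in_cube b f := forall u, gr_coef f u != 0 -> in_cube b u.

Let finite_cube b : finite_set [set u | in_cube b u].
Proof.
pose h (t : {ffun 'I_r -> 'I_(b + b).+1}) := phi (\row_j ((t j)%:Z - b%:Z)).
apply: sub_finite_set (finite_image h (@finite_finset _ setT)) => u /= ub.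
have lt_b (j : 'I_r) : (absz (psi u 0 j + b%:Z)%R < (b + b).+1)%N by have := ub j; lia.
exists [ffun j => Ordinal (lt_b j)] => //; rewrite /h -[RHS]psiK; congr (phi _).
apply/rowP => j; rewrite mxE ffunE /=; have := ub j; lia.
Qed.

(* The distances from u to the faces of the cube of radius b. These are unchanged
   by a simultaneous translation of u and of the box, so that Dickson's lemma for
   them controls both the leading exponents and the supports. *)
Let slack (b : nat) u i : nat :=
  if (insub i : option 'I_r) is Some j then absz (b%:Z + psi u 0%R j)%R
  else if (insub (i - r)%N : option 'I_r) is Some j
  then absz (b%:Z - psi u 0%R j)%R else 0%N.

Let slackl b u (j : 'I_r) : slack b u j = absz (b%:Z + psi u 0%R j)%R.
Proof. by rewrite /slack valK. Qed.

Let slackr b u (j : 'I_r) : slack b u (r + j) = absz (b%:Z - psi u 0%R j)%R.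
Proof. by rewrite /slack insubN ?addKn ?valK// -leqNgt leq_addr. Qed.

(** Divide f by its leading term. Translation by -u takes the cube to the box whose faces lie at the
    distances [slack b u] from 0. *)
Let monic_translate b f u : J f -> supp_in_cube b f -> leading f u ->
  N f = v (gr_coef f u) * W u ->
  exists p, monic p /\ fits p (slack b u).
Proof.
move=> Jf fb [fu flt] Nf; exists (monomial (gr_coef f u)^-1 (- u) * f).
have vV : v (gr_coef f u)^-1 = (v (gr_coef f u))^-1.
  apply: (mulfI (lt0r_neq0 (nabs_gt0 v fu))).
  by rewrite -nabsM !divff ?nabs1 ?gt_eqF ?nabs_gt0.
have WN w : W (- w) = (W w)^-1 by rewrite raddfN opprK expRN invrK.
have NfV : v (gr_coef f u)^-1 * W (- u) * N f = 1.
  by rewrite Nf vV WN -invfM mulVf// gt_eqF// mulr_gt0 ?nabs_gt0.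
split; first split.
- exact: JM.
- by rewrite gr_coef_monomialM sub0r opprK mulVf.
- by rewrite (le_trans (gauss_monomialM _ _ _))// NfV.
- move=> w pw; rewrite gr_coef_monomialM opprK -NfV Nf nabsM.
  have -> : W w = W (- u) * W (w + u) by rewrite -WD addrC addrK.
  rewrite mulrACA ltr_pM2l ?mulr_gt0 ?vV ?invr_gt0 ?nabs_gt0//.
  by apply: flt; rewrite addrK.
- move=> w; rewrite gr_coef_monomialM opprK mulf_eq0 negb_or => /andP[_ fw] j.
  rewrite slackl slackr; have ub := fb _ fu j; have := fb _ fw j.
  rewrite psiD mxE.
  move: ub; move: (psi u 0 j) (psi w 0 j) => x y ub h; apply/andP; split; lia.
Qed.

(** The move back: a box around 0 no larger than the slacks of u stays in the cube when translated
    by u. *)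
Let translate_in_cube b u p d : in_cube b u -> fits p d ->
  (forall i, (i < r + r)%N -> (d i <= slack b u i)%N) ->
  supp_in_cube b (monomial 1 u * p).
Proof.
move=> ub pd db w; rewrite gr_coef_monomialM mul1r => pw j.
have := pd _ pw j; rewrite psiD psiN !mxE.
have := db j (ltn_addr _ (ltn_ord j)); rewrite slackl.
have := db (r + j)%N; rewrite ltn_add2l ltn_ord => /(_ isT); rewrite slackr.
have := ub j.
move: (psi u 0 j) (psi w 0 j) => x y h1 h2 h3 /andP[h4 h5]; lia.
Qed.

(** Inside a cube containing the support of s, division by the basis is finite linear algebra: no
    exponent ever leaves the cube, and elimination loses nothing in the norm. *)
Lemma strict_generators : exists ps : seq KM,
  (forall p, p \in ps -> J p) /\
  forall s, J s -> exists g : KM -> KM,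
    s = \sum_(p <- ps) g p * p /\ forall p, N (g p) <= N s.
Proof.
(* The 2r bounds in d record how far p extends on both sides of 0 in each coordinate; Dickson's
   lemma selects finitely many boxes. *)
pose L := [set d | exists p, monic p /\ fits p d].
have [E [Efin EL Edom]] := dickson (r + r) L.
have /choice[P hP] : forall d, exists p, E d -> monic p /\ fits p d.
  move=> d; have [/EL[p]|nEd] := pselect (E d); first by exists p.
  by exists 0.
have /finite_fsetP[S hS] := finite_image P Efin.
pose ps := undup (S : seq KM).
have psP p : p \in ps -> monic p.
  rewrite mem_undup => pS; have : [set` S] p by [].
  by rewrite -hS => -[d Ed <-]; case: (hP d Ed).
exists ps; split=> [p /psP[]//|s Js].
pose b := (\sum_(u <- gr_supp s) \sum_(j < r) absz (psi u 0%R j))%N.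
have sb : supp_in_cube b s.
  move=> u su j; have us : u \in gr_supp s by rewrite mem_finsupp.
  rewrite /b (big_fsetD1 u)//= (bigD1 j)//=; lia.
pose C := [set u | in_cube b u /\ exists f, [/\ J f, supp_in_cube b f, leading f u &
  N f = v (gr_coef f u) * W u]].
have /finite_fsetP[U hU] : finite_set C.
  by apply: sub_finite_set (finite_cube b) => u [].
have UC u : u \in U -> C u by move=> uU; have : [set` U] u by []; rewrite -hU.
have /choice[q hq] : forall u, exists x, u \in U -> [/\ ball ps (W u) x,
    supp_in_cube b x, gr_coef x u = 1 &
    forall w, pos (w - u) -> v (gr_coef x w) * W w < W u].
  move=> u; have [uU|] := boolP (u \in U); last by exists 0.
  have [ub [f [Jf fb fu Nf]]] := UC _ uU.
  have [e Ee ed] := Edom _ (monic_translate Jf fb fu Nf).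
  have [[Je e0 Ne e_lt] ef] := hP _ Ee.
  exists (monomial 1 u * P e) => _; split.
  - have PeS : P e \in (S : seq KM).
      by have : (P @` E) (P e) by [exists e]; rewrite hS.
    by have := ballM 1 u (ball_mem PeS); rewrite nabs1 mul1r mulr1.
  - exact: translate_in_cube ub ef ed.
  - by rewrite gr_coef_monomialM subrr mul1r.
  - move=> w wu; rewrite gr_coef_monomialM mul1r.
    rewrite -[w in W w](subrK u) WD mulrA -[ltRHS]mul1r ltr_pM2r//.
    exact: e_lt.
(* Elimination runs with norm control and support control at once. *)
pose B c := [set x | ball ps c x /\ supp_in_cube b x].
have [|||||u uU|u uU||x [xs xb] sx] := @elimination B q U _ _ _ _ _ _ _ _ s.
- move=> c x y [xc xb] [yc yb]; split; first exact: ballD.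
  move=> u; rewrite gr_coefD; have [xu|/xb//] := eqVneq (gr_coef x u) 0.
  by rewrite xu add0r; exact: yb.
- move=> c a x [xc xb]; split.
    by have := ballM a 0 xc; rewrite raddf0 oppr0 expR0 mulr1.
  by move=> u; rewrite gr_coef_monomialM subr0 mulf_eq0 negb_or => /andP[_ /xb].
- by move=> c d x cd [xc xb]; split=> //; exact: ball_le xc.
- by move=> c c0; split; [exact: ball0|move=> u; rewrite gr_coef0 eqxx].
- by move=> c x c0 [xc _]; apply: ball_norm xc => // p /psP[].
- by have [] := hq _ uU.
- by have [] := hq _ uU.
- by move=> u w uU; have [_ _ _] := hq _ uU; apply.
have Jx : J x.
  have [g [-> _]] := xs; rewrite big_seq.
  apply: (big_ind J) => [||p /psP[Jp _ _ _]]; [exact: J0|exact: JD|exact: JM].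
(* The remainder lies in J and in the cube. Were it nonzero, its leading exponent would belong to U,
   where its coefficients vanish. *)
have [sx0|/ex_leading[u su Nu]] := eqVneq (s - x) 0.
  have sx' : s = x by apply/eqP; rewrite -subr_eq0 sx0.
  by have [g [xg gN]] := xs; exists g; split=> //; rewrite sx'.
have sxb : supp_in_cube b (s - x).
  move=> w; rewrite gr_coefB; have [xw|/xb//] := eqVneq (gr_coef x w) 0.
  by rewrite xw subr0; exact: sb.
have : C u.
  split; first by apply: sxb; case: su.
  by exists (s - x); split => //; exact: JB.
rewrite hU => /= /sx su0; case: su; by rewrite su0 eqxx.
Qed.

End StrictGenerators.

(** * Residue norms *)

Section Ideals.
Variable A : comNzRingType.
Implicit Types (I P : set A) (f g : A).

Lemma prime_idealP P : is_prime_ideal P <->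
  [/\ is_ideal P, ~ P 1 & forall f g, P (f * g) -> P f \/ P g].
Proof.
split=> [[[P0 P1 PL] PM]|[[P0 PD PM] P1 PP]].
  split; [split=> [|f g Pf Pg|f g Pg]| |].
  - exact: set_mem.
  - have := PL 1 f g (mem_set Pf) (mem_set Pg); rewrite mul1r; exact: set_mem.
  - have := PL f g 0 (mem_set Pg) P0; rewrite addr0; exact: set_mem.
  - by move=> /mem_set; apply/negP.
  - by move=> f g /mem_set/PM/orP[] /set_mem; [left|right].
split; first split; rewrite ?notin_setE ?inE//.
  by move=> a f g; rewrite !inE => Pf Pg; apply: PD => //; exact: PM.
by move=> f g; rewrite !inE => /PP[] ?; apply/orP; [left|right]; rewrite inE.
Qed.

Lemma is_idealB I f g : is_ideal I -> I f -> I g -> I (f - g).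
Proof. by case=> _ D MI If Ig; apply: D => //; rewrite -mulN1r; exact: MI. Qed.

Lemma sub_ideal_generated (E : set A) : E `<=` ideal_generated E.
Proof. exact: sub_gen_smallest. Qed.

Lemma ideal_generated_sub (E I : set A) : is_ideal I -> E `<=` I ->
  ideal_generated E `<=` I.
Proof. by move=> Ii EI; exact: smallest_sub. Qed.

Lemma ideal_generated_ideal (E : set A) : is_ideal (ideal_generated E).
Proof.
split.
- by move=> I [[]].
- by move=> f g hf hg I [Ii EI]; have [_ D _] := Ii; apply: D; [exact: hf|exact: hg].
- by move=> f g hg I [Ii EI]; have [_ _ MI] := Ii; apply: MI; exact: hg.
Qed.

Lemma msn_kernel_ideal (R : realType) (xi : mseminorm A R) :
  is_ideal [set f | xi f = 0].
Proof.
split => [|f g /= f0 g0|f g /= g0]; first exact: msn0.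
  by apply/eqP; rewrite eq_le msn_ge0 (le_trans (msnD _ _ _)) ?f0 ?g0 ?addr0.
by rewrite msnM g0 mulr0.
Qed.

End Ideals.

Section ResidueNorm.
Variables (A : comNzRingType) (R : realType) (N : A -> R) (Q : set A).
Hypotheses (NS : ring_seminorm N) (Qi : is_ideal Q).
Implicit Types (f g : A) (xi : mseminorm A R).

Definition residue_norm : A -> R := dinf (fun (q : {q | Q q}) f => N (f - sval q)).

Let q0 : {q | Q q}. Proof. by exists 0; case: Qi. Qed.
Local Notation F := (fun (q : {q | Q q}) f => N (f - sval q)).
Let N_ge0 q f : 0 <= F q f. Proof. exact: (rsn_ge0 NS). Qed.

Lemma residue_norm_ge0 f : 0 <= residue_norm f.
Proof. exact: (@dinf_ge0 _ _ _ q0 F N_ge0 f). Qed.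

Lemma residue_norm_le f q : Q q -> residue_norm f <= N (f - q).
Proof. by move=> Qq; exact: (@dinf_le _ _ _ q0 F N_ge0 (exist _ q Qq) f). Qed.

Lemma residue_norm_ge f x : (forall q, Q q -> x <= N (f - q)) -> x <= residue_norm f.
Proof. by move=> h; apply: (@dinf_ge _ _ _ q0 F N_ge0) => -[q Qq]; exact: h. Qed.

Lemma residue_norm_lt f x : residue_norm f < x -> exists2 q, Q q & N (f - q) < x.
Proof. by move=> /(@dinf_lt _ _ _ q0 F N_ge0)[[q Qq] h]; exists q. Qed.

Lemma residue_norm_le_norm f : residue_norm f <= N f.
Proof. by rewrite -[f in leRHS]subr0 residue_norm_le//; case: Qi. Qed.

(** Passing to powers removes the constant C, after which xi f <= xi (f - q) <= N (f - q) for every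
    q in Q. *)
Lemma spectrumP xi : spectrum N Q xi <-> forall f, xi f <= residue_norm f.
Proof.
split=> [[[C xiC] xiQ] f|xir].
  have xiN g : xi g <= N g.
    have C0 : 0 <= C by have := xiC 1; rewrite msn1 (rsn1 NS); lra.
    apply: (@le_of_expr_le _ _ _ C) => [||n]; [exact: msn_ge0|exact: (rsn_ge0 NS)|].
    by rewrite -msnX (le_trans (xiC _))// ler_wpM2l// rsnX.
  apply: residue_norm_ge => q Qq; apply: le_trans (xiN _).
  by rewrite -[f in leLHS](subrK q) (le_trans (msnD _ _ _))// (xiQ q)// addr0.
split; first by exists 1 => f; rewrite mul1r (le_trans (xir f))// residue_norm_le_norm.
move=> q Qq; apply/eqP; rewrite eq_le msn_ge0 andbT (le_trans (xir q))//.
by rewrite (le_trans (residue_norm_le _ Qq))// subrr (rsn0 NS).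
Qed.

(** A point xi of the spectrum excludes a zero quotient norm: 1 = xi 1 <= [residue_norm 1]. *)
Lemma residue_norm_seminorm : spectrum N Q !=set0 -> ring_seminorm residue_norm.
Proof.
move=> [xi /spectrumP xir]; have [Q0 QD QM] := Qi; split.
- exact: residue_norm_ge0.
- by apply/eqP; rewrite eq_le residue_norm_ge0 (le_trans (residue_norm_le_norm _)) ?(rsn0 NS).
- apply/eqP; rewrite eq_le (le_trans (residue_norm_le_norm _)) ?(rsn1 NS)//=.
  by rewrite -(msn1 xi).
- move=> f g; apply: le_mul_approx => [||a b]; try exact: residue_norm_ge0.
  move=> /residue_norm_lt[p Qp fp] /residue_norm_lt[q Qq gq].
  (* This element r of Q is chosen so that f g - r = (f - p)(g - q). *)
  have Qr : Q (f * q + p * (g - q)).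
    by apply: QD; [exact: QM|rewrite mulrC; exact: QM].
  apply: le_trans (residue_norm_le _ Qr) _.
  have -> : f * g - (f * q + p * (g - q)) = (f - p) * (g - q) by ring.
  by rewrite (le_trans (rsnM NS _ _))// ler_pM ?(rsn_ge0 NS)// ltW.
- move=> f g; apply: le_of_ltr => a; rewrite gt_max.
  move=> /andP[/residue_norm_lt[p Qp fp] /residue_norm_lt[q Qq gq]].
  apply: le_trans (residue_norm_le _ (QD _ _ Qp Qq)) _.
  rewrite opprD addrACA (le_trans (rsnD NS _ _))// ge_max.
  by rewrite !ltW.
Qed.

Lemma ex_spectrum_peak h t f : 0 <= t -> bounded_below residue_norm h t ->
  spectrum N Q !=set0 -> exists xi, [/\ spectrum N Q xi, t <= xi h &
    forall eta, spectrum N Q eta -> eta f <= xi f].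
Proof.
move=> t0 ht F0; have rs := residue_norm_seminorm F0.
have [xi [xir xif xih]] := ex_peak_point rs f t0 ht.
exists xi; split=> //; first exact/spectrumP.
move=> eta /spectrumP etar; rewrite xif; apply: (mseminorm_le_spectral rs (C := 1)).
by move=> g; rewrite mul1r.
Qed.

End ResidueNorm.

(** * Multiplication on the affinoid algebra of a fiber *)

Section FiberNorm.
Variables (R : realType) (K : fieldType) (v : complete_nonarch_abs R K).
Variables (M : zmodType) (omega : {additive M -> R}).
Local Notation KM := (group_ring K M).
Local Notation T := (tate v omega).
Local Notation iota := (tate_of_group_ring v omega).
Local Notation N := (@tate_norm _ _ v _ omega).
Variables (r : nat) (phi : {additive 'rV[int]_r -> M}) (phi_bij : bijective phi).
Variable (P : set KM).
Local Notation PT := (ideal_generated (iota @` P)).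

(** The elements approximable by P form an ideal because K[M] is dense, and this ideal contains the
    image of P. *)
Lemma ideal_generated_approx (Pi : is_ideal P) (a : T) (e : R) : 0 < e -> PT a ->
  exists2 p, P p & N (a - iota p) <= e.
Proof.
have NS := tate_norm_seminorm v omega; have [P0 PD PM] := Pi.
move=> e0 PTa; suff: [set a | forall e, 0 < e -> exists2 p, P p & N (a - iota p) <= e] a.
  exact.
move: a PTa {e e0}; apply: ideal_generated_sub; last first.
  by move=> _ [p Pp <-] e e0; exists p; rewrite ?subrr ?(rsn0 NS)// ltW.
split => /=.
- by move=> e e0; exists 0; rewrite ?rmorph0 ?subrr ?(rsn0 NS)// ltW.
- move=> a b ha hb e e0; have [p Pp ap] := ha _ e0; have [q Pq bq] := hb _ e0.
  exists (p + q); first exact: PD.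
  by rewrite rmorphD opprD addrACA (le_trans (rsnD NS _ _))// ge_max ap.
- move=> a b hb e e0; have a0 := rsn_ge0 NS a.
  have [|p Pp bp] := hb (e / (N a + 1)); first by rewrite divr_gt0//; lra.
  have p0 := rsn_ge0 NS (iota p).
  have [|f af] := @tate_approx _ _ v _ omega a (e / (N (iota p) + 1)).
    by rewrite divr_gt0//; lra.
  exists (f * p); first exact: PM.
  have -> : a * b - iota (f * p) = a * (b - iota p) + (a - iota f) * iota p.
    by rewrite rmorphM; ring.
  rewrite (le_trans (rsnD NS _ _))// ge_max; apply/andP; split.
    rewrite (le_trans (rsnM NS _ _))//.
    apply: le_trans (_ : N a * (e / (N a + 1)) <= _); first by rewrite ler_wpM2l.
    by rewrite mulrCA ler_piMr ?(ltW e0)// ler_pdivrMr; lra.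
  rewrite (le_trans (rsnM NS _ _))//.
  apply: le_trans (_ : e / (N (iota p) + 1) * N (iota p) <= _); first by rewrite ler_wpM2r.
  by rewrite mulrAC -mulrA ler_piMr ?(ltW e0)// ler_pdivrMr; lra.
Qed.

Hypothesis P_prime : is_prime_ideal P.

(** Strict generators p of (h) + P are congruent to h a_p modulo P. Expanding s over them gives s =
    h b modulo P with b controlled by s; then h (f - b) is in P, hence f - b is too. *)
Lemma prime_bounded_colon h : ~ P h -> exists2 C, 0 < C & forall s f q, P q ->
  s = h * f + q -> exists2 g, P (f - g) & N (iota g) <= C * N (iota s).
Proof.
have [Pi _ PP] := (prime_idealP P).1 P_prime; have [P0 PD PM] := Pi => Ph.
have GS := gauss_seminorm v omega.
pose J := [set s | exists f q, P q /\ s = h * f + q].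
have Ji : is_ideal J.
  split.
  - by exists 0, 0; rewrite mulr0 addr0.
  - move=> _ _ [f [p [Pp ->]]] [g [q [Pq ->]]].
    by exists (f + g), (p + q); split; [exact: PD|rewrite mulrDr addrACA].
  - move=> k _ [f [p [Pp ->]]]; exists (k * f), (k * p).
    by split; [exact: PM|rewrite mulrDr mulrCA].
have [psi phiK psiK] := phi_bij.
have [ps [psJ psg]] := strict_generators v omega phiK psiK Ji.
have /choice[a ha] : forall p, exists a, p \in ps -> P (p - h * a).
  move=> p; have [/psJ[a [q [Pq ->]]]|_] := boolP (p \in ps); last by exists 0.
  by exists a => _; rewrite addrAC subrr add0r.
(* C dominates every [N (iota (a p))]; the summand 1 makes it positive. *)
pose C := 1 + \sum_(p <- ps) N (iota (a p)).
have aC p : p \in ps -> N (iota (a p)) <= C.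
  move=> pps; rewrite /C (big_rem p)//=.
  have : 0 <= \sum_(y <- rem p ps) N (iota (a y)).
    by apply: sumr_ge0 => i _; exact: gauss_ge0.
  lra.
have C0 : 0 < C.
  rewrite /C ltr_pwDl// sumr_ge0// => i _; exact: gauss_ge0.
exists C => // s f q Pq sE.
have [g [sg gs]] : exists g : KM -> KM, s = \sum_(p <- ps) g p * p /\
    forall p, N (iota (g p)) <= N (iota s).
  by apply: psg; exists f, q.
pose b := \sum_(p <- ps) g p * a p.
have Pb : P (s - h * b).
  rewrite sg /b mulr_sumr -sumrB big_seq.
  apply: (big_ind P) => // p pps; rewrite mulrCA -mulrBr; apply: PM; exact: ha.
exists b.
  have : P (h * (f - b)).
    have -> : h * (f - b) = (s - h * b) - q by rewrite sE; ring.
    exact: is_idealB.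
  by case/PP.
apply: (rsn_sum GS); first by rewrite mulr_ge0 ?gauss_ge0// ltW.
move=> p pps; rewrite (le_trans (rsnM GS _ _))// mulrC.
by rewrite ler_pM ?gauss_ge0// aC.
Qed.

(** The bounded division in K[M] passes to the completion: approximate a and q by elements of K[M]
    and P, divide there, and let the error tend to 0. *)
Lemma residue_norm_bounded_below h : ~ P h ->
  exists2 t, 0 < t & bounded_below (residue_norm N PT) (iota h) t.
Proof.
have [Pi _ _] := (prime_idealP P).1 P_prime; have [P0 PD PM] := Pi.
move=> /prime_bounded_colon[C C0 hC]; have NS := tate_norm_seminorm v omega.
have PTi := ideal_generated_ideal (iota @` P).
exists C^-1; first by rewrite invr_gt0.
move=> a; apply: residue_norm_ge => // q PTq.
rewrite ler_pdivrMl//; set x := N (a * iota h - q).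
have x0 : 0 <= x by exact: (rsn_ge0 NS).
pose H := N (iota h); have H0 : 0 <= H by exact: (rsn_ge0 NS).
(* Chosen so that the total error e + C e (H + 1) is exactly d. *)
apply/ler_addgt0Pr => d d0; pose e := d / (1 + C * (H + 1)).
have D0 : 0 < 1 + C * (H + 1) by rewrite ltr_pwDl// mulr_ge0//; lra.
have e0 : 0 < e by rewrite divr_gt0.
have [f af] := @tate_approx _ _ v _ omega a _ e0.
have [p Pp qp] := ideal_generated_approx Pi e0 PTq.
have sx : N (iota (f * h - p)) <= x + e * (H + 1).
  have -> : iota (f * h - p) =
      (a * iota h - q) + ((q - iota p) - (a - iota f) * iota h).
    by rewrite rmorphB rmorphM; ring.
  have eH : 0 <= e * H by rewrite mulr_ge0// ltW.
  rewrite (le_trans (rsnD NS _ _))// ge_max; apply/andP; split; first by rewrite -/x; lra.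
  rewrite (le_trans (tate_normB _ _))// ge_max; apply/andP; split; first by lra.
  rewrite (le_trans (rsnM NS _ _))//.
  apply: le_trans (_ : e * H <= _); first by rewrite ler_wpM2r.
  by lra.
have [|g fg gs] := hC (f * h - p) f (- p) _ (congr1 (fun y => y - p) (mulrC f h)).
  by rewrite -sub0r; exact: is_idealB.
have PTfg : PT (iota (f - g)) by apply: sub_ideal_generated; exists (f - g).
apply: le_trans (residue_norm_le NS PTi _ PTfg) _.
have -> : a - iota (f - g) = (a - iota f) + iota g by rewrite rmorphB; ring.
have Cx : 0 <= C * x by rewrite mulr_ge0// ltW.
have -> : C * x + d = C * x + e + C * (e * (H + 1)).
  by rewrite /e; field; rewrite gt_eqF.
have : C * N (iota (f * h - p)) <= C * (x + e * (H + 1)) by rewrite ler_pM2l.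
rewrite mulrDr => h1.
have h2 : 0 <= C * (e * (H + 1)).
  by apply: mulr_ge0 (ltW C0) (mulr_ge0 (ltW e0) _); rewrite addr_ge0.
rewrite (le_trans (rsnD NS _ _))// ge_max; apply/andP; split; lra.
Qed.

End FiberNorm.

(** * Irreducible components *)

Section IrreducibleComponents.
Variable A : comNzRingType.
Implicit Types (I P Q : set A) (Y F G : set (set A)).

(** P is the generic point: a closed set containing it contains all of [zeros P]. *)
Lemma zeros_irreducible P : is_prime_ideal P -> irreducible_set (zeros P).
Proof.
move=> Pp; have PP : zeros P P by split.
split; first by exists P.
by move=> _ _ [E ->] [E' ->] /(_ _ PP)[[_ EP]|[_ EP]]; [left|right] => Q [Qp PQ];
  split=> //; exact: subset_trans PQ.
Qed.

Lemma vanishing_ideal_prime Y : (forall P, Y P -> is_prime_ideal P) ->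
  irreducible_set Y -> is_prime_ideal (vanishing_ideal Y).
Proof.
move=> Yp [[Q YQ] Yirr]; apply/prime_idealP; split.
- split.
  + by move=> P /Yp/prime_idealP[[]].
  + move=> f g hf hg P YP; have /prime_idealP[[_ D _] _ _] := Yp _ YP.
    by apply: D; [exact: hf|exact: hg].
  + move=> f g hg P YP; have /prime_idealP[[_ _ m] _ _] := Yp _ YP.
    by apply: m; exact: hg.
- by move=> /(_ _ YQ); have /prime_idealP[] := Yp _ YQ.
- move=> f g fg.
  have [||P YP|fY|gY] := Yirr (zeros [set f]) (zeros [set g]).
  + by exists [set f].
  + by exists [set g].
  + have Pp := Yp _ YP; have /prime_idealP[_ _ /(_ _ _ (fg _ YP))] := Pp.
    by case=> h; [left|right]; split => // _ ->.
  + by left => P /fY[_]; apply.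
  + by right => P /gY[_]; apply.
Qed.

Section Components.
Variable I : set A.

Lemma component_prime Y : irreducible_component (zeros I) Y ->
  is_prime_ideal (vanishing_ideal Y).
Proof. by move=> [YI Yi _]; apply: vanishing_ideal_prime => // P /YI[]. Qed.

Lemma component_vanishing Y : irreducible_component (zeros I) Y ->
  I `<=` vanishing_ideal Y.
Proof. by move=> [YI _ _] f If P /YI[_]; apply. Qed.

Lemma component_zeros Y : irreducible_component (zeros I) Y ->
  zeros (vanishing_ideal Y) = Y.
Proof.
move=> Yc; have [YI _ Ymax] := Yc; apply: Ymax.
- move=> P [Pp YP]; split=> //; apply: subset_trans YP.
  exact: component_vanishing.
- exact/zeros_irreducible/component_prime.
- by move=> P YP; split=> [|f /(_ _ YP)//]; case: (YI _ YP).
Qed.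

Lemma component_inj Y Y' : irreducible_component (zeros I) Y ->
  irreducible_component (zeros I) Y' ->
  vanishing_ideal Y `<=` vanishing_ideal Y' -> Y = Y'.
Proof.
move=> Yc Y'c YY'; have [_ _ Y'max] := Y'c; have [YI Yi _] := Yc.
apply: Y'max => //; rewrite -(component_zeros Yc) -(component_zeros Y'c).
by move=> P [Pp Y'P]; split=> //; exact: subset_trans Y'P.
Qed.

(** Zorn's lemma on the irreducible subsets of [zeros I] through the point Q, starting from
    [zeros Q]. *)
Lemma ex_component Q : is_prime_ideal Q -> I `<=` Q ->
  exists2 Y, irreducible_component (zeros I) Y & vanishing_ideal Y `<=` Q.
Proof.
move=> Qp IQ.
pose good Y := [/\ Y `<=` zeros I, irreducible_set Y & Y Q].
have gQ : good (zeros Q).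
  split; last by split.
    by move=> P [Pp QP]; split=> //; exact: subset_trans QP.
  exact: zeros_irreducible.
pose leT (Y1 Y2 : {Y | good Y}) := `[< sval Y1 `<=` sval Y2 >].
have [|||C Ctot|[Y [YI Yi YQ]] Ymax] := @Zorn {Y | good Y} leT.
- by move=> Y; apply/asboolP.
- by move=> X Y Z /asboolP XY /asboolP YZ; apply/asboolP; exact: subset_trans YZ.
- move=> [Y gY] [Z gZ] /asboolP YZ /asboolP ZY; apply: eq_exist.
  exact/seteqP.
- have [[Y0 CY0]|C0] := pselect (exists Y : {Y | good Y}, C Y); last first.
    by exists (exist _ _ gQ) => Y CY; case: C0; exists Y.
  pose U := \bigcup_(Y in C) sval Y.
  have gU : good U.
    split.
    + by move=> P [[Y [YI Yi YQ]] _ /YI].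
    + split; first by exists Q, Y0 => //; case: (svalP Y0).
      move=> F G Fc Gc UFG; apply: contrapT => /not_orP[nF nG].
      have [Y1 CY1 Y1F] : exists2 Y : {Y | good Y}, C Y & ~ (sval Y `<=` F).
        apply: contrapT => h; apply: nF => P [Y CY YP]; apply: contrapT => FP.
        by apply: h; exists Y => // /(_ _ YP).
      have [Y2 CY2 Y2G] : exists2 Y : {Y | good Y}, C Y & ~ (sval Y `<=` G).
        apply: contrapT => h; apply: nG => P [Y CY YP]; apply: contrapT => GP.
        by apply: h; exists Y => // /(_ _ YP).
      (* The larger of the two members is contained neither in F nor in G, against its
         irreducibility. *)
      have [Y [CY Y1Y Y2Y]] : exists Y : {Y | good Y},
          [/\ C Y, sval Y1 `<=` sval Y & sval Y2 `<=` sval Y].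
        by case: (Ctot _ _ CY1 CY2) => /asboolP h; [exists Y2|exists Y1]; split.
      have [_ [_ Yi] _] := svalP Y.
      have [|YF|YG] := Yi F G Fc Gc.
      * by move=> P YP; apply: UFG; exists Y.
      * by apply: Y1F; exact: subset_trans YF.
      * by apply: Y2G; exact: subset_trans YG.
    + by exists Y0 => //; case: (svalP Y0).
  by exists (exist _ _ gU) => Y CY; apply/asboolP => P YP; exists Y.
exists Y; last by move=> f; apply.
split=> // Z ZI Zi YZ.
have gZ : good Z by split=> //; exact: YZ.
have := Ymax (exist _ _ gZ) => /(_ _)/(congr1 sval); apply.
exact/asboolP.
Qed.

End Components.
End IrreducibleComponents.

(** * Topology of the spectrum *)

Section SpectrumTopology.
Variables (A : comNzRingType) (R : realType).
Implicit Types (xi : mseminorm A R) (N : A -> R) (Q : set A).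

Lemma msn_eval_continuous f : continuous (fun xi : mseminorm A R => xi f).
Proof.
move=> xi; apply: (@continuous_comp _ _ _ (@msn A R : _ -> {ptws A -> R}) (fun g => g f)).
  exact: initial_continuous.
exact: (@proj_continuous A (fun=> R) f).
Qed.

Section ClosedSets.
Variables (T : topologicalType) (h : T -> R) (c : R).
Hypothesis hc : continuous h.

Lemma closed_preimage_le : closed [set x | h x <= c].
Proof. exact: ((continuous_closedP h).1 hc _ (@closed_le _ c)). Qed.

Lemma closed_preimage_ge : closed [set x | c <= h x].
Proof. exact: ((continuous_closedP h).1 hc _ (@closed_ge _ c)). Qed.

Lemma closed_preimage_eq : closed [set x | h x = c].
Proof. exact: ((continuous_closedP h).1 hc _ (@closed_eq _ c)). Qed.

End ClosedSets.

Section ClosedConditions.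
Variables (T : topologicalType) (e : A -> T -> R).
Hypothesis e_cont : forall f, continuous (e f).

(** Stated for arbitrary continuous [e] so as to apply on the product space, where a limit of
    seminorms is at first a mere function. *)
Lemma closed_mseminorm_axioms : closed [set x |
  [/\ forall f, 0 <= e f x, e 0 x = 0, e 1 x = 1,
     forall f g, e (f * g) x = e f x * e g x &
     forall f g, e (f + g) x <= e f x + e g x]].
Proof.
have -> : [set x | [/\ forall f, 0 <= e f x, e 0 x = 0, e 1 x = 1,
     forall f g, e (f * g) x = e f x * e g x &
     forall f g, e (f + g) x <= e f x + e g x]] =
  \bigcap_(f in setT) [set x | 0 <= e f x] `&` [set x | e 0 x = 0] `&`
  [set x | e 1 x = 1] `&`
  \bigcap_(f in setT) \bigcap_(g in setT) [set x | e (f * g) x - e f x * e g x = 0] `&`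
  \bigcap_(f in setT) \bigcap_(g in setT) [set x | e (f + g) x - (e f x + e g x) <= 0].
  apply/seteqP; split=> x /=.
    move=> [h0 hz h1 hM hD]; split; [split; [split; [split|]|]|] => //.
    - by move=> f _; exact: h0.
    - by move=> f _ g _ /=; rewrite hM subrr.
    - by move=> f _ g _ /=; rewrite subr_le0.
  move=> [[[[h0 hz] h1] hM] hD]; split => //.
  - by move=> f; exact: (h0 f I).
  - by move=> f g; apply/eqP; rewrite -subr_eq0; apply/eqP; exact: (hM f I g I).
  - by move=> f g; rewrite -subr_le0; exact: (hD f I g I).
have cM f g : continuous (fun x => e (f * g) x - e f x * e g x).
  by move=> x; apply: cvgB; [|apply: cvgM]; exact: e_cont.
have cD f g : continuous (fun x => e (f + g) x - (e f x + e g x)).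
  by move=> x; apply: cvgB; [|apply: cvgD]; exact: e_cont.
apply: closedI; [apply: closedI; [apply: closedI; [apply: closedI|]|]|].
- by apply: (@closed_bigI _ _ setT) => f _; exact: closed_preimage_ge.
- exact: closed_preimage_eq.
- exact: closed_preimage_eq.
- apply: (@closed_bigI _ _ setT) => f _; apply: (@closed_bigI _ _ setT) => g _.
  exact: closed_preimage_eq.
- apply: (@closed_bigI _ _ setT) => f _; apply: (@closed_bigI _ _ setT) => g _.
  exact: closed_preimage_le.
Qed.

End ClosedConditions.

Lemma closed_msn_le f c : closed [set xi : mseminorm A R | xi f <= c].
Proof. exact: closed_preimage_le (@msn_eval_continuous f). Qed.

Lemma closed_msn_ge f c : closed [set xi : mseminorm A R | c <= xi f].
Proof. exact: closed_preimage_ge (@msn_eval_continuous f). Qed.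

Lemma closed_msn_eq0 f : closed [set xi : mseminorm A R | xi f = 0].
Proof. exact: closed_preimage_eq (@msn_eval_continuous f). Qed.

Lemma closed_spectrum N Q : ring_seminorm N -> is_ideal Q -> closed (spectrum N Q).
Proof.
move=> NS Qi.
have -> : spectrum N Q = \bigcap_(f in setT) [set xi | xi f <= residue_norm N Q f].
  by apply/seteqP; split=> xi => [/(spectrumP NS Qi) h f _|h]; [exact: h|
    apply/(spectrumP NS Qi) => f; exact: h].
by apply: (@closed_bigI _ _ setT) => f _; exact: closed_msn_le.
Qed.

(** The spectrum sits in a product of segments, compact by Tychonoff; a cluster point there is again
    a seminorm, the axioms being closed conditions. *)
Lemma compact_spectrum N Q : ring_seminorm N -> is_ideal Q -> compact (spectrum N Q).
Proof.
move=> NS Qi.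
pose B := [set g : {ptws A -> R} | forall f, [set` `[0, residue_norm N Q f]] (g f)].
have Bc : compact B := @tychonoff A (fun=> R) _ (fun f => @segment_compact _ _ _).
pose m : mseminorm A R -> {ptws A -> R} := @msn A R.
move=> F PF FS.
have FB : (m @ F) B.
  suff : F (m @^-1` B) by [].
  apply: (filterS _ FS) => xi xiS f /=.
  rewrite in_itv/=; apply/andP; split; first exact: msn_ge0.
  exact: ((spectrumP NS Qi xi).1 xiS).
have [g [Bg gF]] := Bc _ (fmap_proper_filter _ PF) FB.
have proj_cont f : continuous (fun g : {ptws A -> R} => g f).
  exact: (@proj_continuous A (fun=> R) f).
have closed_g (C : set {ptws A -> R}) : closed C -> (forall xi, C (msn xi)) -> C g.
  move=> Cc CF; apply: Cc => U Ug.
  have FC : F (m @^-1` C) by apply: (filterS _ FS) => xi _; exact: CF.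
  by have [k []] := gF C U FC Ug; exists k.
have [g0 gz g1 gM gD] : [/\ forall f, 0 <= g f, g 0 = 0, g 1 = 1,
    forall a b, g (a * b) = g a * g b & forall a b, g (a + b) <= g a + g b].
  apply: (closed_g _ (closed_mseminorm_axioms proj_cont)) => xi.
  by split; [exact: msn_ge0|exact: msn0|exact: msn1|exact: msnM|exact: msnD].
exists (MSeminorm g0 gz g1 gM gD); split.
  by apply/(spectrumP NS Qi) => f; have /= := Bg f; rewrite in_itv/= => /andP[].
move=> U V FU [_ [[W Wo <-] Wg WV]].
have FmU : F (m @^-1` (m @` U)) by apply: (filterS _ FU) => eta Ueta; exists eta.
have [k [[eta Ueta <-] Weta]] := gF (m @` U) W FmU (open_nbhs_nbhs (conj Wo Wg)).
by exists eta; split => //; exact: WV.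
Qed.

Lemma closed_subset_subspace (S G : set (mseminorm A R)) : closed S -> G `<=` S ->
  closed (G : set (subspace S)) <-> closed G.
Proof.
move=> Sc GS; split=> [/closed_subspaceP[V Vc VS]|]; last exact: closed_subspaceW.
by rewrite -(setIidl GS) -VS; exact: closedI.
Qed.

End SpectrumTopology.

(** * Shilov boundaries of the fibers *)

Section ShilovFibers.
Variables (R : realType) (K : fieldType) (v : complete_nonarch_abs R K).
Variables (M : zmodType) (omega : {additive M -> R}).
Local Notation KM := (group_ring K M).
Local Notation T := (tate v omega).
Local Notation iota := (tate_of_group_ring v omega).
Local Notation N := (@tate_norm _ _ v _ omega).
Local Notation fiber J := (@tropical_fiber _ _ v _ J omega).
Implicit Types (eta xi : mseminorm T R) (J P : set KM) (f h : KM).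

Lemma tropical_fiberP J eta : fiber J eta <->
  (exists C, forall a, eta a <= C * N a) /\ forall f, J f -> eta (iota f) = 0.
Proof.
split=> [[etaC etaJ]|[etaC etaJ]]; split=> //.
  by move=> f Jf; apply: etaJ; apply: sub_ideal_generated; exists f.
apply: ideal_generated_sub; first exact: msn_kernel_ideal.
by move=> _ [f Jf <-]; exact: etaJ.
Qed.

Lemma tropical_fiberS J P : J `<=` P -> fiber P `<=` fiber J.
Proof.
move=> JP eta /tropical_fiberP[etaC etaP]; apply/tropical_fiberP.
by split=> // f /JP; exact: etaP.
Qed.

Lemma closed_tropical_fiber J : closed (fiber J).
Proof.
exact: closed_spectrum (tate_norm_seminorm v omega) (ideal_generated_ideal _).
Qed.

Lemma compact_tropical_fiber J : compact (fiber J).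
Proof.
exact: compact_spectrum (tate_norm_seminorm v omega) (ideal_generated_ideal _).
Qed.

Lemma msn_kernel_prime (A : comNzRingType) (B : comNzRingType)
    (g : {rmorphism A -> B}) (xi : mseminorm B R) :
  is_prime_ideal [set f | xi (g f) = 0].
Proof.
have [K0 KD KM'] := msn_kernel_ideal xi.
apply/prime_idealP; split=> [||f h /=].
- split=> [|f h|f h] /=; first by rewrite rmorph0 msn0.
  + by rewrite rmorphD; exact: KD.
  + by rewrite rmorphM; exact: KM'.
- by move=> /eqP /=; rewrite rmorph1 msn1 oner_eq0.
- by rewrite rmorphM msnM => /eqP; rewrite mulf_eq0 => /orP[]/eqP; [left|right].
Qed.

Lemma fiber_boundary_closed J (G : set (mseminorm T R)) :
  is_boundary (fiber J) G -> closed G.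
Proof.
move=> [GS Gc _].
exact: (closed_subset_subspace (@closed_tropical_fiber J) GS).1 Gc.
Qed.

Variables (r : nat) (phi : {additive 'rV[int]_r -> M}) (phi_bij : bijective phi).

(** It matters that t does not depend on a: one closed set then carries the maxima of all
    functions. *)
Lemma fiber_peak P h : is_prime_ideal P -> ~ P h -> exists2 t, 0 < t &
  forall a, fiber P !=set0 -> exists xi, [/\ fiber P xi, t <= xi (iota h) &
    forall eta, fiber P eta -> eta a <= xi a].
Proof.
move=> Pp Ph; have [t t0 ht] := residue_norm_bounded_below v omega phi_bij Pp Ph.
exists t => // a F0.
by apply: ex_spectrum_peak ht F0; [exact: tate_norm_seminorm|
  exact: ideal_generated_ideal|exact: ltW].
Qed.

Lemma shilov_boundary_kernel P eta : is_prime_ideal P ->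
  shilov_boundary (fiber P) eta ->
  fiber P eta /\ forall h, eta (iota h) = 0 -> P h.
Proof.
move=> Pp etaS.
have inG (G : set (mseminorm T R)) : is_boundary (fiber P) G -> G eta.
  by move=> GB; apply: etaS; split.
have H h : ~ P h -> exists2 t, 0 < t & fiber P eta /\ t <= eta (iota h).
  move=> Ph; have [t t0 ht] := fiber_peak Pp Ph; exists t => //.
  apply: (inG [set xi | fiber P xi /\ t <= xi (iota h)]); split.
  - by move=> xi [].
  - apply: closed_subspaceW; apply: closedI; first exact: closed_tropical_fiber.
    exact: closed_msn_ge.
  - by move=> a /(ht a)[xi [? ? ?]]; exists xi.
(* Membership in the fiber comes from h = 1, which lies outside P. *)
split; first by have [_ P1 _] := (prime_idealP P).1 Pp; have [t _ []] := H 1 P1.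
move=> h h0; apply: contrapT => /H[t t0 []]; rewrite h0; lra.
Qed.

Variables (I : set KM) (n : nat) (P : 'I_n -> set KM).
Hypothesis P_prime : forall i, is_prime_ideal (P i).
Hypothesis IP : forall i, I `<=` P i.
Hypothesis P_incomparable : forall i j, P i `<=` P j -> i = j.
Hypothesis P_minimal : forall Q, is_prime_ideal Q -> I `<=` Q -> exists i, P i `<=` Q.

Lemma ex_fiber_component eta : fiber I eta -> exists i, fiber (P i) eta.
Proof.
move=> /tropical_fiberP[etaC etaI].
have [|i Pi] := P_minimal (msn_kernel_prime iota eta); first exact: etaI.
by exists i; apply/tropical_fiberP.
Qed.

(** Otherwise each component has a boundary missing eta, and their finite union would be a boundary
    of the whole fiber missing eta. *)
Lemma shilov_boundary_fiber_sub eta : shilov_boundary (fiber I) eta ->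
  exists i, shilov_boundary (fiber (P i)) eta.
Proof.
move=> etaS; apply: contrapT => /forallNP h.
have /choice[G hG] : forall i, exists G, is_boundary (fiber (P i)) G /\ ~ G eta.
  move=> i; apply: contrapT => /forallNP hi; apply: (h i) => G [GB _].
  by apply: contrapT => nG; apply: (hi G).
suff : is_boundary (fiber I) (\bigcup_(i in setT) G i).
  by move=> GB; have [//|i _] := etaS _ (conj GB _); case: (hG i).
split.
- move=> xi [i _ Gxi]; have [[GS _ _] _] := hG i.
  exact: tropical_fiberS (IP i) _ (GS _ Gxi).
- apply: closed_subspaceW; apply: closed_bigcup => [|i _]; first exact: finite_finset.
  by have [/fiber_boundary_closed] := hG i.
- move=> a F0.
  have [xi Fxi xi_max] : exists2 xi, fiber I xi &
      forall eta, fiber I eta -> eta a <= xi a.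
    have [xi0 Fxi0] := F0.
    have [c] := @compact_EVT_max _ _ (fun xi : mseminorm T R => xi a) _ F0
      (@compact_tropical_fiber I) (continuous_subspaceT (@msn_eval_continuous _ _ a)).
    rewrite inE => Fc cmax; exists c => // xi Fxi; apply: cmax; exact: mem_set.
  have [i Fi] := ex_fiber_component Fxi.
  have [[_ _ Gi] _] := hG i.
  have [|zeta Gzeta zmax] := Gi a; first by exists xi.
  exists zeta; first by exists i.
  by move=> th /xi_max h1; apply: le_trans h1 (zmax _ Fi).
Qed.

(** Multiply elements of the P j outside P i, given by incomparability; the product stays outside
    the prime P i. *)
Lemma ex_component_separator i : exists2 h, ~ P i h & forall j, j != i -> P j h.
Proof.
have /choice[h hP] : forall j, exists h, j != i -> P j h /\ ~ P i h.
  move=> j; have [->|ji] := eqVneq j i; first by exists 0.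
  have [f Pjf Pif] : exists2 f, P j f & ~ P i f.
    apply: contrapT => hn; move/eqP: ji; apply; apply: P_incomparable => f Pjf.
    by apply: contrapT => Pif; apply: hn; exists f.
  by exists f.
exists (\prod_(j | j != i) h j) => [|j ji].
  have [_ Pi1 PiM] := (prime_idealP _).1 (P_prime i).
  apply: (big_ind (fun f => ~ P i f)) => // [f g nf ng /PiM[]//|j /hP[]//].
have [[_ _ m] _ _] := (prime_idealP _).1 (P_prime j).
by rewrite (bigD1 j)//= mulrC; apply: m; have [] := hP j ji.
Qed.

Lemma shilov_boundary_component i eta : shilov_boundary (fiber (P i)) eta ->
  shilov_boundary (fiber I) eta.
Proof.
move=> etaS G [GB _]; have [GS Gc' Gmax] := GB.
have Gc := fiber_boundary_closed GB.
suff : is_boundary (fiber (P i)) (G `&` fiber (P i)).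
  by move=> B; have [] := etaS _ (conj B (@sub0set _ _)).
have [h Pih Pjh] := ex_component_separator i.
have [t t0 ht] := fiber_peak (P_prime i) Pih.
have Fc := @closed_tropical_fiber (P i).
split; first by move=> xi [].
  by apply: closed_subspaceW; exact: closedI.
move=> a F0; have [xi [Fxi xih xi_max]] := ht a F0.
have FI0 : fiber I !=set0 by exists xi; exact: tropical_fiberS (IP i) _ Fxi.
(* Maximize a^k h over G. Since h vanishes on the other components, a maximizer with |h| > 0 lies
   over component i. *)
have peak k : exists zeta, [/\ G zeta, zeta a ^+ k * zeta (iota h) >= xi a ^+ k * t &
    0 < zeta (iota h) -> fiber (P i) zeta].
  have [zeta Gz zmax] := Gmax (a ^+ k * iota h) FI0; exists zeta; split=> //.
    have := zmax xi (tropical_fiberS (IP i) Fxi).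
    rewrite !msnM !msnX; apply: le_trans.
    by rewrite ler_wpM2l// exprn_ge0// msn_ge0.
  have [j] := ex_fiber_component (GS _ Gz).
  have [->//|ji] := eqVneq j i.
  by move=> /tropical_fiberP[_ /(_ _ (Pjh _ ji)) ->]; rewrite ltxx.
(* For k = 0 the maximizer has |h| >= t > 0. *)
have GF0 : (G `&` fiber (P i)) !=set0.
  have [zeta [Gz + Fz]] := peak 0%N; rewrite !expr0 !mul1r => tz.
  by exists zeta; split=> //; apply: Fz; exact: lt_le_trans tz.
have GFc : compact (G `&` fiber (P i)).
  by rewrite setIC; apply: compact_closedI => //; exact: compact_tropical_fiber.
have [c] := compact_EVT_max GF0 GFc
  (continuous_subspaceT (@msn_eval_continuous _ _ a)).
rewrite inE => GFc' cmax; exists c => // th /xi_max/le_trans; apply.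
apply: (@le_of_expr_le _ _ _ (N (iota h) / t)) => [||k]; try exact: msn_ge0.
rewrite mulrAC ler_pdivlMr//.
(* With c maximizing |a| on the intersection, t xi(a)^k <= zeta(a)^k zeta(h) <= c(a)^k N(h) when
   zeta(h) > 0; otherwise the middle term is 0. *)
have [zeta [Gz zk Fz]] := peak k.
have zN : zeta (iota h) <= N (iota h).
  have NS := tate_norm_seminorm v omega.
  have ITi := ideal_generated_ideal (iota @` I).
  apply: le_trans (residue_norm_le_norm NS ITi _).
  exact: ((spectrumP NS ITi zeta).1 (GS _ Gz)).
apply: le_trans zk _; rewrite mulrC.
have [z0|z0] := ltP 0 (zeta (iota h)).
  rewrite ler_pM ?exprn_ge0 ?msn_ge0// lerXn2r ?nnegrE ?msn_ge0//.
  by apply: cmax; apply: mem_set; split=> //; exact: Fz.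
apply: le_trans (_ : 0 <= _).
  by rewrite mulr_le0_ge0// exprn_ge0// msn_ge0.
rewrite mulr_ge0 ?exprn_ge0 ?msn_ge0//.
exact: rsn_ge0 (tate_norm_seminorm v omega) _.
Qed.

End ShilovFibers.

(** * Decomposition of the tropical skeleton *)

Lemma closed_ideal_kernel (A : comNzRingType) (R : realType) (P : set A) :
  closed [set xi : mseminorm A R | forall f, P f -> xi f = 0].
Proof.
have -> : [set xi : mseminorm A R | forall f, P f -> xi f = 0] =
  \bigcap_(f in P) [set xi : mseminorm A R | xi f = 0] by [].
by apply: (@closed_bigI _ _ P) => f _; exact: closed_msn_eq0.
Qed.

Theorem proposition4p7 (R : realType) (K : fieldType)
    (v : complete_nonarch_abs R K) (M : zmodType)
    (r : nat) (phi : {additive 'rV[int]_r -> M}) (phi_bij : bijective phi)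
    (I : set (group_ring K M)) (I_ideal : is_ideal I)
    (n : nat) (X : 'I_n -> set (set (group_ring K M))) (X_inj : injective X)
    (X_components : range X = irreducible_component (zeros I)) :
  let S := tropical_skeleton v I in
  let S_ i := tropical_skeleton v (vanishing_ideal (X i)) in
  [/\ S = \bigcup_(i in [set: 'I_n]) S_ i,
      trivIset [set: 'I_n] S_ &
      forall i, open (S_ i : set (subspace S)) /\
                closed (S_ i : set (subspace S))].
Proof.
move=> S S_; pose P i := vanishing_ideal (X i).
have Xc i : irreducible_component (zeros I) (X i) by rewrite -X_components; exists i.
have Pp i : is_prime_ideal (P i) by exact: component_prime (Xc i).
have IP i : I `<=` P i by exact: component_vanishing (Xc i).
have Pinc i j : P i `<=` P j -> i = j.
  by move=> Pij; apply: X_inj; exact: component_inj (Xc i) (Xc j) Pij.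
have Pmin Q : is_prime_ideal Q -> I `<=` Q -> exists i, P i `<=` Q.
  move=> Qp IQ; have [Y Yc YQ] := ex_component Qp IQ.
  by move: Yc; rewrite -X_components => -[i _ YE]; exists i; rewrite /P YE.
(* The kernel of a point of the skeleton recovers its component; this yields both disjointness and
   the closed description below. *)
have Sker i xi : S_ i xi -> forall f, xi f = 0 <-> P i f.
  move=> [[_ xiP] [eta etaS xiE]] f; split; last exact: xiP.
  have [_ etaker] := shilov_boundary_kernel phi_bij (Pp i) etaS.
  by rewrite xiE; exact: etaker.
have SiS i : S_ i `<=` S.
  move=> xi [[xiv xiP] [eta etaS xiE]]; split.
    by split=> // f /(IP i)/xiP.
  exists eta => //; exact: (shilov_boundary_component phi_bij Pp IP Pinc Pmin etaS).
have SE : S = \bigcup_(i in [set: 'I_n]) S_ i.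
  apply/seteqP; split=> [xi [[xiv xiI] [eta etaS xiE]]|xi [i _]]; last exact: SiS.
  have [i etaSi] := shilov_boundary_fiber_sub IP Pmin etaS.
  exists i => //; split; last by exists eta.
  split=> // f Pf.
  have [/tropical_fiberP[_ etaP] _] := shilov_boundary_kernel phi_bij (Pp i) etaSi.
  by rewrite xiE; exact: etaP.
pose C i := [set xi : mseminorm (group_ring K M) R | forall f, P i f -> xi f = 0].
have Ccl i : closed (C i) by exact: closed_ideal_kernel.
have SC i xi : S xi -> C i xi <-> S_ i xi.
  rewrite SE => -[j _ Sj]; split=> [Ci|/Sker xiP f]; last by move=> /xiP.
  (* The point lies in S_j, so its kernel is P j; vanishing on P i then gives P i inside P j. *)
  suff -> : i = j by [].
  by apply: Pinc => f /Ci; apply: (Sker _ _ Sj f).1.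
split=> //.
- move=> i j _ _ [xi [Si Sj]]; apply: Pinc => f Pf.
  exact/(Sker _ _ Sj)/(Sker _ _ Si).
- move=> i; split; last first.
    apply/closed_subspaceP; exists (C i) => //.
    by apply/seteqP; split=> xi [h Sxi]; split=> //; exact/SC.
  apply/open_subspaceP.
  (* The other pieces are closed and finite in number, so S_i is the trace of the complement of
     their union. *)
  exists (~` \bigcup_(j in [set j | j != i]) C j).
    by apply: closed_openC; apply: closed_bigcup => //; exact: finite_finset.
  apply/seteqP; split=> xi [h Sxi]; split=> //.
    move: (Sxi); rewrite SE => -[j _ Sj].
    have [<-//|ji] := eqVneq j i.
    by case: h; exists j => //; exact/SC.
  move=> [j /= ji /(SC _ _ Sxi) Sj]; move/eqP: ji; apply.
  by apply: Pinc => f /(Sker _ _ Sj)/(Sker _ _ h).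
Qed.
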